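(* Let $\mathbb{X}$ be a differential category with differential modality $(\mathsf{S},\mu,\eta,\mathsf{m},\mathsf{u},\mathsf{d})$ and with finite biproducts. Then $\mathsf{S}\text{-}\mathsf{DER}$ is a tangent category whose tangent bundle functor $\mathsf{T}$ sends an $\mathsf{S}$-derivation $\mathsf{D}\colon(A,\nu)\to(M,\alpha)$ to $$\mathsf{T}\big(\mathsf{D}\colon(A,\nu)\to(M,\alpha)\big)=\left(\begin{bmatrix}\mathsf{D}&0\\0&\mathsf{D}\end{bmatrix}\colon(A\oplus A,\nu^\flat)\to(M\oplus M,\alpha^\flat)\right),$$ where $$\nu^\flat=\begin{bmatrix}\nu\circ\mathsf{S}\left(\begin{bmatrix}1_A&0\end{bmatrix}\right)\\ \mathsf{m}^\nu\circ(\nu\otimes 1_A)\circ\left(\mathsf{S}\left(\begin{bmatrix}1_A&0\end{bmatrix}\right)\otimes\begin{bmatrix}0&1_A\end{bmatrix}\right)\circ\mathsf{d}_{A\oplus A}\end{bmatrix}\colon\mathsf{S}(A\oplus A)\to A\oplus A,$$ and the action $\alpha^\flat\colon(A\oplus A)\otimes(M\oplus M)\to M\oplus M$ is induced, up to the distributivity isomorphism $(A\oplus A)\otimes(M\oplus M)\cong(A\otimes M)\oplus(A\otimes M)\oplus(A\otimes M)\oplus(A\otimes M)$, by the matrix $$\begin{bmatrix}\alpha&0&0&0\\0&\alpha&\alpha&0\end{bmatrix}\colon(A\otimes M)\oplus(A\otimes M)\oplus(A\otimes M)\oplus(A\otimes M)\to M\oplus M.$$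
   Context: Symmetric monoidal categories $(\mathbb{X},\otimes,I)$ are written as strict (associators and unitors treated as identities), with symmetry $\sigma_{A,B}\colon A\otimes B\to B\otimes A$. An additive category is a category enriched over commutative monoids: each hom-set is a commutative monoid $(+,0)$ and composition preserves $+$ and $0$ in each argument (no negatives assumed). An additive symmetric monoidal category is a symmetric monoidal category that is additive and such that $\otimes$ of maps preserves $+$ and $0$ in each argument. Biproducts are written $\oplus$; maps between biproducts are written as matrices. $\otimes$ distributes over $\oplus$; the four summands of $(A\oplus A)\otimes(M\oplus M)$ are ordered lexicographically (first$\otimes$first, first$\otimes$second, second$\otimes$first, second$\otimes$second). An algebra modality on a symmetric monoidal category is $(\mathsf{S},\mu,\eta,\mathsf{m},\mathsf{u})$ where $(\mathsf{S},\mu,\eta)$ is a monad ($\mu_A\colon\mathsf{S}\mathsf{S}(A)\to\mathsf{S}(A)$, $\eta_A\colon A\to\mathsf{S}(A)$) and $\mathsf{m}_A\colon\mathsf{S}(A)\otimes\mathsf{S}(A)\to\mathsf{S}(A)$, $\mathsf{u}_A\colon I\to\mathsf{S}(A)$ are natural transformations such that each $(\mathsf{S}(A),\mathsf{m}_A,\mathsf{u}_A)$ is a commutative monoid and each $\mu_A$ is a monoid morphism $(\mathsf{S}\mathsf{S}(A),\mathsf{m}_{\mathsf{S}(A)},\mathsf{u}_{\mathsf{S}(A)})\to(\mathsf{S}(A),\mathsf{m}_A,\mathsf{u}_A)$. A differential modality on an additive symmetric monoidal category is an algebra modality with a natural transformation $\mathsf{d}_A\colon\mathsf{S}(A)\to\mathsf{S}(A)\otimes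 A$ (the deriving transformation) such that [D.1] $\mathsf{d}_A\circ\mathsf{u}_A=0$; [D.2] $\mathsf{d}_A\circ\mathsf{m}_A=(\mathsf{m}_A\otimes 1_A)\circ\big((1_{\mathsf{S}(A)}\otimes\mathsf{d}_A)+(1_{\mathsf{S}(A)}\otimes\sigma_{A,\mathsf{S}(A)})\circ(\mathsf{d}_A\otimes 1_{\mathsf{S}(A)})\big)$; [D.3] $\mathsf{d}_A\circ\eta_A=\mathsf{u}_A\otimes 1_A$; [D.4] $\mathsf{d}_A\circ\mu_A=(\mathsf{m}_A\otimes 1_A)\circ(\mu_A\otimes\mathsf{d}_A)\circ\mathsf{d}_{\mathsf{S}(A)}$; [D.5] $(1_{\mathsf{S}(A)}\otimes\sigma_{A,A})\circ(\mathsf{d}_A\otimes 1_A)\circ\mathsf{d}_A=(\mathsf{d}_A\otimes 1_A)\circ\mathsf{d}_A$. A differential category is an additive symmetric monoidal category equipped with a differential modality. $\mathsf{S}$-algebras and their morphisms are the Eilenberg–Moore ones. Every $\mathsf{S}$-algebra $(A,\nu)$ carries a commutative monoid structure $(A,\mathsf{m}^\nu,\mathsf{u}^\nu)$ with $\mathsf{m}^\nu=\nu\circ\mathsf{m}_A\circ(\eta_A\otimes\eta_A)$ and $\mathsf{u}^\nu=\nu\circ\mathsf{u}_A$. A module over a commutative monoid $(A,\mathsf{m},\mathsf{u})$ is $(M,\alpha\colon A\otimes M\to M)$ with $\alpha\circ(1_A\otimes\alpha)=\alpha\circ(\mathsf{m}\otimes 1_M)$ and $\alpha\circ(\mathsf{u}\otimes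 1_M)=1_M$; an $(A,\nu)$-module means an $(A,\mathsf{m}^\nu,\mathsf{u}^\nu)$-module. An $\mathsf{S}$-derivation $\mathsf{D}\colon(A,\nu)\to(M,\alpha)$, for an $\mathsf{S}$-algebra $(A,\nu)$ and an $(A,\nu)$-module $(M,\alpha)$, is a map $\mathsf{D}\colon A\to M$ with $\mathsf{D}\circ\nu=\alpha\circ(\nu\otimes\mathsf{D})\circ\mathsf{d}_A$. An $\mathsf{S}$-derivation morphism from $\mathsf{D}\colon(A,\nu)\to(M,\alpha)$ to $\mathsf{D}'\colon(A',\nu')\to(M',\alpha')$ is a pair $(f,g)$ with $f\colon(A,\nu)\to(A',\nu')$ an $\mathsf{S}$-algebra morphism and $g\colon M\to M'$ a map such that $g\circ\alpha=\alpha'\circ(f\otimes g)$ and $g\circ\mathsf{D}=\mathsf{D}'\circ f$. These form the category $\mathsf{S}\text{-}\mathsf{DER}$. Tangent category (Cockett–Cruttwell): a category $\mathbb{Y}$ with an endofunctor $\mathsf{T}$ (the tangent bundle functor) and natural transformations $p\colon\mathsf{T}\to 1$, $s\colon\mathsf{T}_2\to\mathsf{T}$, $z\colon 1\to\mathsf{T}$, $\ell\colon\mathsf{T}\to\mathsf{T}^2$, $c\colon\mathsf{T}^2\to\mathsf{T}^2$ such that: (1) for each object $X$ and $n$, the pullback $\mathsf{T}_n(X)$ of $n$ copies of $p_X$ exists and is preserved by every power $\mathsf{T}^k$; (2) $(p_X\colon\mathsf{T}X\to X,s_X,z_X)$ is a commutative monoid in the slice $\mathbb{Y}/X$ (an additive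 bundle); (3) $(\ell_X,z_X)$ is a morphism of additive bundles (commutes with projections, additions and zeros) from $(p_X,s_X,z_X)$ to $(\mathsf{T}(p_X)\colon\mathsf{T}^2X\to\mathsf{T}X,\mathsf{T}(s_X),\mathsf{T}(z_X))$; (4) $(c_X,1_{\mathsf{T}X})$ is a morphism of additive bundles from $(\mathsf{T}(p_X),\mathsf{T}(s_X),\mathsf{T}(z_X))$ to $(p_{\mathsf{T}X},s_{\mathsf{T}X},z_{\mathsf{T}X})$; (5) $c\circ c=1$, $c\circ\ell=\ell$, $\mathsf{T}(\ell)\circ\ell=\ell_{\mathsf{T}}\circ\ell$, $\mathsf{T}(c)\circ c_{\mathsf{T}}\circ\mathsf{T}(c)=c_{\mathsf{T}}\circ\mathsf{T}(c)\circ c_{\mathsf{T}}$, $c_{\mathsf{T}}\circ\mathsf{T}(c)\circ\ell_{\mathsf{T}}=\mathsf{T}(\ell)\circ c$; (6) with $v_X=\mathsf{T}(s_X)\circ\langle\ell_X\circ\pi_1,z_{\mathsf{T}X}\circ\pi_2\rangle\colon\mathsf{T}_2X\to\mathsf{T}^2X$, the square formed by $v_X$, $\mathsf{T}(p_X)\colon\mathsf{T}^2X\to\mathsf{T}X$, $p_X\circ\pi_1\colon\mathsf{T}_2X\to X$ and $z_X\colon X\to\mathsf{T}X$ is a pullback, preserved by every power $\mathsf{T}^k$. *)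

(* Defs.v *)
From mathcomp Require Import all_boot.
From Stdlib Require Import ProofIrrelevance.
Set Implicit Arguments.
Unset Strict Implicit.
Unset Printing Implicit Defensive.

Declare Scope cat_scope.
Delimit Scope cat_scope with cat.
Local Open Scope cat_scope.

Record Category := MkCategory {
  obj :> Type;
  hom : obj -> obj -> Type;
  idm : forall A, hom A A;
  compm : forall A B C, hom B C -> hom A B -> hom A C;
  compm1 : forall A B (f : hom A B), compm f (idm A) = f;
  comp1m : forall A B (f : hom A B), compm (idm B) f = f;
  compmA : forall A B C D (h : hom C D) (g : hom B C) (f : hom A B),
    compm h (compm g f) = compm (compm h g) f }.

Arguments hom {c} A B : rename.
Arguments idm {c} A : rename.
Arguments compm {c A B C} g f : rename.

Notation "g ∘ f" := (compm g f) (at level 40, left associativity) : cat_scope.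
Notation "'1_' A" := (idm A) (at level 8, A at level 2, format "'1_' A") : cat_scope.

Record Functor (C D : Category) := MkFunctor {
  fobj :> C -> D;
  fmap : forall A B : C, hom A B -> hom (fobj A) (fobj B);
  fmap1 : forall A : C, fmap (1_ A) = 1_ (fobj A);
  fmapM : forall (A B E : C) (g : hom B E) (f : hom A B),
    fmap (g ∘ f) = fmap g ∘ fmap f }.

Arguments fmap {C D} F {A B} f : rename.

Definition functor_id (C : Category) : Functor C C :=
  @MkFunctor C C id (fun _ _ f => f) (fun _ => erefl) (fun _ _ _ _ _ => erefl).

Lemma functor_comp1 (C D E : Category) (G : Functor D E) (F : Functor C D) A :
  fmap G (fmap F (1_ A)) = 1_ (G (F A)).
Proof. by rewrite !fmap1. Qed.

Lemma functor_compM (C D E : Category) (G : Functor D E) (F : Functor C D)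
    (A B K : C) (g : hom B K) (f : hom A B) :
  fmap G (fmap F (g ∘ f)) = fmap G (fmap F g) ∘ fmap G (fmap F f).
Proof. by rewrite !fmapM. Qed.

Definition functor_comp (C D E : Category) (G : Functor D E) (F : Functor C D) :
    Functor C E :=
  @MkFunctor C E (fun A => G (F A)) (fun _ _ f => fmap G (fmap F f))
    (functor_comp1 G F) (functor_compM G F).

Fixpoint functor_pow (C : Category) (T : Functor C C) (k : nat) : Functor C C :=
  if k is k'.+1 then functor_comp T (functor_pow T k') else functor_id C.

(* Strictness is not assumed: the associators and unitors are explicit. *)
Record SymMonCat := MkSymMonCat {
  smc_cat :> Category;
  tens : smc_cat -> smc_cat -> smc_cat;
  tensm : forall A B A' B' : smc_cat,
    hom A A' -> hom B B' -> hom (tens A B) (tens A' B');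
  munit : smc_cat;
  massoc : forall A B C, hom (tens (tens A B) C) (tens A (tens B C));
  massoci : forall A B C, hom (tens A (tens B C)) (tens (tens A B) C);
  mlunit : forall A, hom (tens munit A) A;
  mluniti : forall A, hom A (tens munit A);
  mrunit : forall A, hom (tens A munit) A;
  mruniti : forall A, hom A (tens A munit);
  msym : forall A B, hom (tens A B) (tens B A);
  tensm1 : forall A B, tensm (1_ A) (1_ B) = 1_ (tens A B);
  tensmM : forall (A B C A' B' C' : smc_cat)
      (g : hom B C) (f : hom A B) (g' : hom B' C') (f' : hom A' B'),
    tensm (g ∘ f) (g' ∘ f') = tensm g g' ∘ tensm f f';
  massocK : forall A B C, massoci A B C ∘ massoc A B C = 1_ _;
  massociK : forall A B C, massoc A B C ∘ massoci A B C = 1_ _;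
  mlunitK : forall A, mluniti A ∘ mlunit A = 1_ _;
  mlunitiK : forall A, mlunit A ∘ mluniti A = 1_ _;
  mrunitK : forall A, mruniti A ∘ mrunit A = 1_ _;
  mrunitiK : forall A, mrunit A ∘ mruniti A = 1_ _;
  msymK : forall A B, msym B A ∘ msym A B = 1_ _;
  massoc_nat : forall (A B C A' B' C' : smc_cat)
      (f : hom A A') (g : hom B B') (h : hom C C'),
    massoc A' B' C' ∘ tensm (tensm f g) h = tensm f (tensm g h) ∘ massoc A B C;
  mlunit_nat : forall (A A' : smc_cat) (f : hom A A'),
    mlunit A' ∘ tensm (1_ munit) f = f ∘ mlunit A;
  mrunit_nat : forall (A A' : smc_cat) (f : hom A A'),
    mrunit A' ∘ tensm f (1_ munit) = f ∘ mrunit A;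
  msym_nat : forall (A B A' B' : smc_cat) (f : hom A A') (g : hom B B'),
    msym A' B' ∘ tensm f g = tensm g f ∘ msym A B;
  mpentagon : forall A B C D,
    massoc A B (tens C D) ∘ massoc (tens A B) C D
    = tensm (1_ A) (massoc B C D) ∘ massoc A (tens B C) D
        ∘ tensm (massoc A B C) (1_ D);
  mtriangle : forall A B,
    tensm (1_ A) (mlunit B) ∘ massoc A munit B = tensm (mrunit A) (1_ B);
  mhexagon : forall A B C,
    massoc B C A ∘ msym A (tens B C) ∘ massoc A B C
    = tensm (1_ B) (msym A C) ∘ massoc B A C ∘ tensm (msym A B) (1_ C) }.

Arguments tensm {s A B A' B'} f g : rename.
Arguments munit {s} : rename.
Arguments massoc {s} A B C : rename.
Arguments massoci {s} A B C : rename.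
Arguments mlunit {s} A : rename.
Arguments mluniti {s} A : rename.
Arguments mrunit {s} A : rename.
Arguments mruniti {s} A : rename.
Arguments msym {s} A B : rename.

Notation "A ⊗ B" := (tens A B) (at level 35, right associativity) : cat_scope.
Notation "f ⊠ g" := (tensm f g) (at level 35, right associativity) : cat_scope.

(* Additive means enriched over commutative monoids; no negatives. *)
Record AddSymMonCat := MkAddSymMonCat {
  asmc_smc :> SymMonCat;
  addm : forall A B : asmc_smc, hom A B -> hom A B -> hom A B;
  zerom : forall A B : asmc_smc, hom A B;
  addmA : forall A B, associative (@addm A B);
  addmC : forall A B, commutative (@addm A B);
  add0m : forall A B, left_id (zerom A B) (@addm A B);
  compmDl : forall (A B C : asmc_smc) (g g' : hom B C) (f : hom A B),
    addm g g' ∘ f = addm (g ∘ f) (g' ∘ f);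
  compmDr : forall (A B C : asmc_smc) (g : hom B C) (f f' : hom A B),
    g ∘ addm f f' = addm (g ∘ f) (g ∘ f');
  comp0m : forall (A B C : asmc_smc) (f : hom A B), zerom B C ∘ f = zerom A C;
  compm0 : forall (A B C : asmc_smc) (g : hom B C), g ∘ zerom A B = zerom A C;
  tensmDl : forall (A B A' B' : asmc_smc) (f f' : hom A A') (g : hom B B'),
    addm f f' ⊠ g = addm (f ⊠ g) (f' ⊠ g);
  tensmDr : forall (A B A' B' : asmc_smc) (f : hom A A') (g g' : hom B B'),
    f ⊠ addm g g' = addm (f ⊠ g) (f ⊠ g');
  tens0m : forall (A B A' B' : asmc_smc) (g : hom B B'),
    zerom A A' ⊠ g = zerom (A ⊗ B) (A' ⊗ B');
  tensm0 : forall (A B A' B' : asmc_smc) (f : hom A A'),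
    f ⊠ zerom B B' = zerom (A ⊗ B) (A' ⊗ B') }.

Arguments addm {a A B} f g : rename.
Arguments zerom {a} A B : rename.

Notation "f + g" := (addm f g) : cat_scope.
Notation "0" := (zerom _ _) : cat_scope.

Record FiniteBiproducts (X : AddSymMonCat) := MkFiniteBiproducts {
  bzero : X;
  bzero_initial : forall (A : X) (f : hom bzero A), f = 0;
  bzero_terminal : forall (A : X) (f : hom A bzero), f = 0;
  bip : X -> X -> X;
  bpi1 : forall A B, hom (bip A B) A;
  bpi2 : forall A B, hom (bip A B) B;
  bin1 : forall A B, hom A (bip A B);
  bin2 : forall A B, hom B (bip A B);
  bpi1in1 : forall A B, bpi1 A B ∘ bin1 A B = 1_ A;
  bpi2in2 : forall A B, bpi2 A B ∘ bin2 A B = 1_ B;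
  bpi1in2 : forall A B, bpi1 A B ∘ bin2 A B = 0;
  bpi2in1 : forall A B, bpi2 A B ∘ bin1 A B = 0;
  bip_sum : forall A B,
    bin1 A B ∘ bpi1 A B + bin2 A B ∘ bpi2 A B = 1_ (bip A B) }.

Section Matrices.
Variables (X : AddSymMonCat) (BP : FiniteBiproducts X).
Local Notation "A ⊕ B" := (bip BP A B) (at level 36, right associativity).
Local Notation π1 := (bpi1 BP _ _).
Local Notation π2 := (bpi2 BP _ _).
Local Notation ι1 := (bin1 BP _ _).
Local Notation ι2 := (bin2 BP _ _).

(* The 1 x 2 matrix [f g]. *)
Definition mrow (A B C : X) (f : hom A C) (g : hom B C) : hom (A ⊕ B) C :=
  f ∘ π1 + g ∘ π2.

(* The 2 x 1 matrix with rows f and g. *)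
Definition mcol (A B C : X) (f : hom C A) (g : hom C B) : hom C (A ⊕ B) :=
  ι1 ∘ f + ι2 ∘ g.

Definition distr (A B M N : X) :
    hom ((A ⊕ B) ⊗ (M ⊕ N)) ((A ⊗ M ⊕ A ⊗ N) ⊕ (B ⊗ M ⊕ B ⊗ N)) :=
  mcol (mcol (π1 ⊠ π1) (π1 ⊠ π2)) (mcol (π2 ⊠ π1) (π2 ⊠ π2)).

Definition distr_inv (A B M N : X) :
    hom ((A ⊗ M ⊕ A ⊗ N) ⊕ (B ⊗ M ⊕ B ⊗ N)) ((A ⊕ B) ⊗ (M ⊕ N)) :=
  mrow (mrow (ι1 ⊠ ι1) (ι1 ⊠ ι2)) (mrow (ι2 ⊠ ι1) (ι2 ⊠ ι2)).

Lemma addm0 (A B : X) (f : hom A B) : f + 0 = f.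
Proof. by rewrite addmC add0m. Qed.

Lemma mrow_col (A B C D : X) (f : hom A D) (g : hom B D)
    (f' : hom C A) (g' : hom C B) :
  mrow f g ∘ mcol f' g' = f ∘ f' + g ∘ g'.
Proof.
rewrite /mrow /mcol compmDl !compmDr -!compmA.
rewrite (compmA (bpi1 BP A B)) bpi1in1 (compmA (bpi1 BP A B)) bpi1in2.
rewrite (compmA (bpi2 BP A B)) bpi2in1 (compmA (bpi2 BP A B)) bpi2in2.
by rewrite !comp1m !comp0m !compm0 addm0 add0m.
Qed.

Lemma pi1_col (A B C : X) (f : hom C A) (g : hom C B) : π1 ∘ mcol f g = f.
Proof.
by rewrite /mcol compmDr !compmA bpi1in1 bpi1in2 comp1m comp0m addm0.
Qed.

Lemma pi2_col (A B C : X) (f : hom C A) (g : hom C B) : π2 ∘ mcol f g = g.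
Proof.
by rewrite /mcol compmDr !compmA bpi2in1 bpi2in2 comp1m comp0m add0m.
Qed.

Lemma mcol_comp (A B C D : X) (f : hom C A) (g : hom C B) (h : hom D C) :
  mcol f g ∘ h = mcol (f ∘ h) (g ∘ h).
Proof. by rewrite /mcol compmDl !compmA. Qed.

Lemma mrow_eta (A B C : X) (h : hom (A ⊕ B) C) : mrow (h ∘ ι1) (h ∘ ι2) = h.
Proof. by rewrite /mrow -!compmA -compmDr bip_sum compm1. Qed.

Lemma mcol_row (A B C D : X) (f : hom A C) (g : hom B C)
    (f' : hom A D) (g' : hom B D) :
  mcol (mrow f g) (mrow f' g') = mrow (mcol f f') (mcol g g').
Proof.
rewrite /mrow /mcol !compmDr !compmDl !compmA -!addmA; congr (_ + _).
by rewrite addmC -addmA; congr (_ + _); rewrite addmC.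
Qed.

Lemma mrow1 (A B : X) : mrow ι1 ι2 = 1_ (A ⊕ B).
Proof. exact: bip_sum. Qed.

Lemma comp_mrow (A B C D : X) (f : hom A C) (g : hom B C) (h : hom C D) :
  h ∘ mrow f g = mrow (h ∘ f) (h ∘ g).
Proof. by rewrite /mrow compmDr !compmA. Qed.

Lemma mcol0 (A B C : X) : mcol (zerom C A) (zerom C B) = 0.
Proof. by rewrite /mcol !compm0 addm0. Qed.

Lemma distrK (A B M N : X) :
  distr_inv A B M N ∘ distr A B M N = 1_ ((A ⊕ B) ⊗ (M ⊕ N)).
Proof.
rewrite /distr_inv /distr !mrow_col -!tensmM.
by rewrite -!tensmDr -tensmDl !bip_sum tensm1.
Qed.

Lemma distr_invK (A B M N : X) :
  distr A B M N ∘ distr_inv A B M N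
  = 1_ ((A ⊗ M ⊕ A ⊗ N) ⊕ (B ⊗ M ⊕ B ⊗ N)).
Proof.
rewrite /distr /distr_inv !comp_mrow !mcol_comp -!tensmM.
rewrite !(bpi1in1, bpi2in2, bpi1in2, bpi2in1) !(tens0m, tensm0, tensm1).
have i1E (A' B' : X) : mcol (1_ A') (zerom A' B') = ι1.
  by rewrite /mcol compm1 compm0 addm0.
have i2E (A' B' : X) : mcol (zerom B' A') (1_ B') = ι2.
  by rewrite /mcol compm1 compm0 add0m.
have r0 (P Q R : X) : mrow (zerom P R) (zerom Q R) = 0.
  by rewrite /mrow !comp0m addm0.
rewrite !mcol0 !i1E !i2E -!mcol_row !r0 !mrow1.
by rewrite mcol_row i1E i2E mrow1.
Qed.

End Matrices.

Record is_comm_monoid (X : SymMonCat) (A : X)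
    (m : hom (A ⊗ A) A) (u : hom munit A) : Prop := {
  cmonA : m ∘ (1_ A ⊠ m) ∘ massoc A A A = m ∘ (m ⊠ 1_ A);
  cmon1 : m ∘ (u ⊠ 1_ A) ∘ mluniti A = 1_ A;
  cmonC : m ∘ msym A A = m }.

Record is_module (X : SymMonCat) (A : X) (m : hom (A ⊗ A) A) (u : hom munit A)
    (M : X) (α : hom (A ⊗ M) M) : Prop := {
  modA : α ∘ (1_ A ⊠ α) ∘ massoc A A M = α ∘ (m ⊠ 1_ M);
  mod1 : α ∘ (u ⊠ 1_ M) ∘ mluniti M = 1_ M }.

Record AlgebraModality (X : SymMonCat) := MkAlgebraModality {
  am_S :> Functor X X;
  am_mu : forall A : X, hom (am_S (am_S A)) (am_S A);
  am_eta : forall A : X, hom A (am_S A);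
  am_m : forall A : X, hom (am_S A ⊗ am_S A) (am_S A);
  am_u : forall A : X, hom munit (am_S A);
  am_mu_nat : forall (A B : X) (f : hom A B),
    fmap am_S f ∘ am_mu A = am_mu B ∘ fmap am_S (fmap am_S f);
  am_eta_nat : forall (A B : X) (f : hom A B),
    fmap am_S f ∘ am_eta A = am_eta B ∘ f;
  am_m_nat : forall (A B : X) (f : hom A B),
    fmap am_S f ∘ am_m A = am_m B ∘ (fmap am_S f ⊠ fmap am_S f);
  am_u_nat : forall (A B : X) (f : hom A B), fmap am_S f ∘ am_u A = am_u B;
  am_muA : forall A, am_mu A ∘ am_mu (am_S A) = am_mu A ∘ fmap am_S (am_mu A);
  am_mu_eta : forall A, am_mu A ∘ am_eta (am_S A) = 1_ (am_S A);
  am_mu_Seta : forall A, am_mu A ∘ fmap am_S (am_eta A) = 1_ (am_S A);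
  am_monoid : forall A, is_comm_monoid (am_m A) (am_u A);
  am_mu_m : forall A,
    am_mu A ∘ am_m (am_S A) = am_m A ∘ (am_mu A ⊠ am_mu A);
  am_mu_u : forall A, am_mu A ∘ am_u (am_S A) = am_u A }.

Arguments am_mu {X} S A : rename.
Arguments am_eta {X} S A : rename.
Arguments am_m {X} S A : rename.
Arguments am_u {X} S A : rename.

Record DifferentialModality (X : AddSymMonCat) := MkDifferentialModality {
  dm_am :> AlgebraModality X;
  dm_d : forall A : X, hom (dm_am A) (dm_am A ⊗ A);
  dm_d_nat : forall (A B : X) (f : hom A B),
    (fmap dm_am f ⊠ f) ∘ dm_d A = dm_d B ∘ fmap dm_am f;
  dm_d_u : forall A, dm_d A ∘ am_u dm_am A = 0;
  dm_d_m : forall A,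
    dm_d A ∘ am_m dm_am A
    = (am_m dm_am A ⊠ 1_ A)
      ∘ (massoci (dm_am A) (dm_am A) A ∘ (1_ (dm_am A) ⊠ dm_d A)
         + massoci (dm_am A) (dm_am A) A ∘ (1_ (dm_am A) ⊠ msym A (dm_am A))
             ∘ massoc (dm_am A) A (dm_am A) ∘ (dm_d A ⊠ 1_ (dm_am A)));
  dm_d_eta : forall A,
    dm_d A ∘ am_eta dm_am A = (am_u dm_am A ⊠ 1_ A) ∘ mluniti A;
  dm_d_mu : forall A,
    dm_d A ∘ am_mu dm_am A
    = (am_m dm_am A ⊠ 1_ A) ∘ massoci (dm_am A) (dm_am A) A
        ∘ (am_mu dm_am A ⊠ dm_d A) ∘ dm_d (dm_am A);
  dm_d_d : forall A,
    (1_ (dm_am A) ⊠ msym A A) ∘ massoc (dm_am A) A A ∘ (dm_d A ⊠ 1_ A) ∘ dm_d A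
    = massoc (dm_am A) A A ∘ (dm_d A ⊠ 1_ A) ∘ dm_d A }.

Arguments dm_d {X} S A : rename.

Section SDER.
Variables (X : AddSymMonCat) (S : DifferentialModality X).

Record is_algebra (A : X) (ν : hom (S A) A) : Prop := {
  alg1 : ν ∘ am_eta S A = 1_ A;
  algM : ν ∘ am_mu S A = ν ∘ fmap S ν }.

Definition alg_m (A : X) (ν : hom (S A) A) : hom (A ⊗ A) A :=
  ν ∘ am_m S A ∘ (am_eta S A ⊠ am_eta S A).

Definition alg_u (A : X) (ν : hom (S A) A) : hom munit A := ν ∘ am_u S A.

Definition is_derivation (A : X) (ν : hom (S A) A) (M : X)
    (α : hom (A ⊗ M) M) (D : hom A M) : Prop :=
  D ∘ ν = α ∘ (ν ⊠ D) ∘ dm_d S A.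

(* The data of an S-derivation is kept apart from its axioms, so that equality
   of objects of S-DER can be stated as equality of data. *)
Record DerData := MkDerData {
  der_A : X;
  der_nu : hom (S der_A) der_A;
  der_M : X;
  der_alpha : hom (der_A ⊗ der_M) der_M;
  der_D : hom der_A der_M }.

Record is_Sderivation (D : DerData) : Prop := {
  der_alg : is_algebra (der_nu D);
  der_mod : is_module (alg_m (der_nu D)) (alg_u (der_nu D)) (der_alpha D);
  der_der : is_derivation (der_nu D) (der_alpha D) (der_D D) }.

Record Derivation := MkDerivation {
  der_data :> DerData;
  der_ax : is_Sderivation der_data }.

Record DerMor (D D' : Derivation) := MkDerMor {
  dmor_f : hom (der_A D) (der_A D');
  dmor_g : hom (der_M D) (der_M D');
  dmor_alg : dmor_f ∘ der_nu D = der_nu D' ∘ fmap S dmor_f;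
  dmor_mod : dmor_g ∘ der_alpha D = der_alpha D' ∘ (dmor_f ⊠ dmor_g);
  dmor_der : dmor_g ∘ der_D D = der_D D' ∘ dmor_f }.

Lemma DerMor_eq (D D' : Derivation) (h k : DerMor D D') :
  dmor_f h = dmor_f k -> dmor_g h = dmor_g k -> h = k.
Proof.
case: h k => [f g p q r] [f' g' p' q' r'] /= ef eg; subst f' g'.
by rewrite (proof_irrelevance _ p p') (proof_irrelevance _ q q')
  (proof_irrelevance _ r r').
Qed.

Definition der_id (D : Derivation) : DerMor D D.
Proof.
refine (@MkDerMor D D (1_ _) (1_ _) _ _ _).
- by rewrite fmap1 comp1m compm1.
- by rewrite tensm1 comp1m compm1.
- by rewrite comp1m compm1.
Defined.

Definition der_comp (D E F : Derivation) (k : DerMor E F) (h : DerMor D E) :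
  DerMor D F.
Proof.
refine (@MkDerMor D F (dmor_f k ∘ dmor_f h) (dmor_g k ∘ dmor_g h) _ _ _).
- by rewrite fmapM -compmA dmor_alg !compmA dmor_alg.
- by rewrite tensmM -compmA dmor_mod !compmA dmor_mod.
- by rewrite -compmA dmor_der !compmA dmor_der.
Defined.

Definition SDER : Category.
Proof.
refine (@MkCategory Derivation DerMor der_id der_comp _ _ _).
- by move=> D E f; apply: DerMor_eq; rewrite /= compm1.
- by move=> D E f; apply: DerMor_eq; rewrite /= comp1m.
- by move=> D E F G h g f; apply: DerMor_eq; rewrite /= compmA.
Defined.

Variable BP : FiniteBiproducts X.
Local Notation "A ⊕ B" := (bip BP A B) (at level 36, right associativity).

Definition nu_flat (A : X) (ν : hom (S A) A) : hom (S (A ⊕ A)) (A ⊕ A) :=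
  mcol BP (ν ∘ fmap S (mrow BP (1_ A) 0))
          (alg_m ν ∘ (ν ⊠ 1_ A)
             ∘ (fmap S (mrow BP (1_ A) 0) ⊠ mrow BP 0 (1_ A))
             ∘ dm_d S (A ⊕ A)).

Definition alpha_flat (A M : X) (α : hom (A ⊗ M) M) :
    hom ((A ⊕ A) ⊗ (M ⊕ M)) (M ⊕ M) :=
  mcol BP (mrow BP (mrow BP α 0) (mrow BP 0 0))
          (mrow BP (mrow BP 0 α) (mrow BP α 0))
  ∘ distr BP A A M M.

Definition D_flat (A M : X) (D : hom A M) : hom (A ⊕ A) (M ⊕ M) :=
  mcol BP (mrow BP D 0) (mrow BP 0 D).

Definition der_flat (D : DerData) : DerData :=
  @MkDerData (der_A D ⊕ der_A D) (nu_flat (der_nu D))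
             (der_M D ⊕ der_M D) (alpha_flat (der_alpha D))
             (D_flat (der_D D)).

End SDER.

Section Tangent.
Variable Y : Category.

(* [P], with [base : P -> X] and [pr i : P -> E], is the pullback of [n] copies
   of [p : E -> X]. The leg [base] is redundant for n > 0 and makes P
   isomorphic to X for n = 0. *)
Record FibrePower (n : nat) (E X : Y) (p : hom E X)
    (P : Y) (base : hom P X) (pr : 'I_n -> hom P E) := MkFibrePower {
  fp_comm : forall i, p ∘ pr i = base;
  fp_lift : forall (Z : Y) (b : hom Z X) (a : 'I_n -> hom Z E),
    (forall i, p ∘ a i = b) -> hom Z P;
  fp_lift_base : forall Z b a (pa : forall i, p ∘ a i = b),
    base ∘ @fp_lift Z b a pa = b;
  fp_lift_pr : forall Z b a (pa : forall i, p ∘ a i = b) i,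
    pr i ∘ @fp_lift Z b a pa = a i;
  fp_lift_uniq : forall (Z : Y) (h k : hom Z P), base ∘ h = base ∘ k ->
    (forall i, pr i ∘ h = pr i ∘ k) -> h = k }.

Record is_pullback (A B C P : Y) (f : hom A C) (g : hom B C)
    (p1 : hom P A) (p2 : hom P B) : Prop := {
  pb_comm : f ∘ p1 = g ∘ p2;
  pb_univ : forall (Z : Y) (a : hom Z A) (b : hom Z B), f ∘ a = g ∘ b ->
    exists! h : hom Z P, p1 ∘ h = a /\ p2 ∘ h = b }.

Definition fam2 (Z E : Y) (x y : hom Z E) : 'I_2 -> hom Z E :=
  fun i => if i == ord0 then x else y.

Lemma fam2P (Z E X : Y) (p : hom E X) (b : hom Z X) (x y : hom Z E) :
  p ∘ x = b -> p ∘ y = b -> forall i, p ∘ fam2 x y i = b.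
Proof. by move=> px py i; rewrite /fam2; case: (i == ord0). Qed.

(* The pairing <x, y> : Z -> P for P the fibre product of p with itself. *)
Definition fp_pair (E X : Y) (p : hom E X) (P : Y) (base : hom P X)
    (pr : 'I_2 -> hom P E) (F : FibrePower p base pr)
    (Z : Y) (b : hom Z X) (x y : hom Z E)
    (px : p ∘ x = b) (py : p ∘ y = b) : hom Z P :=
  fp_lift F (fam2P px py).

Record BundleData := MkBundleData {
  ab_E : Y;
  ab_X : Y;
  ab_p : hom ab_E ab_X;
  ab_E2 : Y;
  ab_base : hom ab_E2 ab_X;
  ab_pr : 'I_2 -> hom ab_E2 ab_E;
  ab_fp : FibrePower ab_p ab_base ab_pr;
  ab_s : hom ab_E2 ab_E;
  ab_z : hom ab_X ab_E }.

Lemma bundle_s_over (B : BundleData) (ps : ab_p B ∘ ab_s B = ab_base B)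
    (Z : Y) (b : hom Z (ab_X B)) (x y : hom Z (ab_E B))
    (px : ab_p B ∘ x = b) (py : ab_p B ∘ y = b) :
  ab_p B ∘ (ab_s B ∘ fp_pair (ab_fp B) px py) = b.
Proof. by rewrite compmA ps fp_lift_base. Qed.

Lemma bundle_z_over (B : BundleData) (pz : ab_p B ∘ ab_z B = 1_ (ab_X B)) :
  ab_p B ∘ (ab_z B ∘ ab_p B) = ab_p B.
Proof. by rewrite compmA pz comp1m. Qed.

(* (p, s, z) is a commutative monoid in the slice over X; associativity is
   stated on generalized elements x, y, w of E over X, of which the three
   projections of the triple fibre power of p are the universal instance. *)
Record is_additive_bundle (B : BundleData) : Prop := {
  ab_ps : ab_p B ∘ ab_s B = ab_base B;
  ab_pz : ab_p B ∘ ab_z B = 1_ (ab_X B);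
  ab_sA : forall (Z : Y) (b : hom Z (ab_X B)) (x y w : hom Z (ab_E B))
      (px : ab_p B ∘ x = b) (py : ab_p B ∘ y = b) (pw : ab_p B ∘ w = b),
    ab_s B ∘ fp_pair (ab_fp B) px (bundle_s_over ab_ps py pw)
    = ab_s B ∘ fp_pair (ab_fp B) (bundle_s_over ab_ps px py) pw;
  ab_sC : ab_s B ∘ fp_pair (ab_fp B) (fp_comm (ab_fp B) ord_max)
                                     (fp_comm (ab_fp B) ord0) = ab_s B;
  ab_s0 : ab_s B ∘ fp_pair (ab_fp B) (bundle_z_over ab_pz) (compm1 (ab_p B))
          = 1_ (ab_E B) }.

Lemma bundle_morph_over (B B' : BundleData)
    (f : hom (ab_E B) (ab_E B')) (g : hom (ab_X B) (ab_X B'))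
    (pf : ab_p B' ∘ f = g ∘ ab_p B) i :
  ab_p B' ∘ (f ∘ ab_pr B i) = g ∘ ab_base B.
Proof. by rewrite compmA pf -compmA (fp_comm (ab_fp B)). Qed.

Record is_bundle_morph (B B' : BundleData)
    (f : hom (ab_E B) (ab_E B')) (g : hom (ab_X B) (ab_X B')) : Prop := {
  bm_p : ab_p B' ∘ f = g ∘ ab_p B;
  bm_s : f ∘ ab_s B = ab_s B' ∘ fp_lift (ab_fp B') (bundle_morph_over bm_p);
  bm_z : f ∘ ab_z B = ab_z B' ∘ g }.

Record TangentData := MkTangentData {
  tan_T : Functor Y Y;
  tan_p : forall X, hom (tan_T X) X;
  tan_Tn : nat -> Y -> Y;
  tan_base : forall n X, hom (tan_Tn n X) X;
  tan_pr : forall n X, 'I_n -> hom (tan_Tn n X) (tan_T X);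
  (* k = 0: T_n X is the n-th fibre power of p_X; k > 0: T^k preserves it. *)
  tan_fp : forall k n X,
    FibrePower (fmap (functor_pow tan_T k) (tan_p X))
               (fmap (functor_pow tan_T k) (tan_base n X))
               (fun i => fmap (functor_pow tan_T k) (tan_pr X i));
  tan_s : forall X, hom (tan_Tn 2 X) (tan_T X);
  tan_z : forall X, hom X (tan_T X);
  tan_l : forall X, hom (tan_T X) (tan_T (tan_T X));
  tan_c : forall X, hom (tan_T (tan_T X)) (tan_T (tan_T X)) }.

Section TangentLaws.
Variable t : TangentData.
Local Notation T := (tan_T t).
Local Notation p := (tan_p t).
Local Notation s := (tan_s t).
Local Notation z := (tan_z t).
Local Notation l := (tan_l t).
Local Notation c := (tan_c t).

Definition tan_bundle (X : Y) : BundleData :=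
  @MkBundleData (T X) X (p X) (tan_Tn t 2 X) (tan_base t 2 X)
    (fun i => tan_pr t X i) (tan_fp t 0 2 X) (s X) (z X).

Definition tan_Tbundle (X : Y) : BundleData :=
  @MkBundleData (T (T X)) (T X) (fmap T (p X))
    (T (tan_Tn t 2 X)) (fmap T (tan_base t 2 X))
    (fun i => fmap T (tan_pr t X i)) (tan_fp t 1 2 X)
    (fmap T (s X)) (fmap T (z X)).

Lemma tan_vert_l (X : Y) : fmap T (p X) ∘ l X = z X ∘ p X ->
  fmap T (p X) ∘ (l X ∘ tan_pr t X (@ord0 1)) = z X ∘ tan_base t 2 X.
Proof.
by move=> pl; rewrite compmA pl -compmA; congr (_ ∘ _);
   exact: (fp_comm (tan_fp t 0 2 X)).
Qed.

Lemma tan_vert_z (X : Y) : fmap T (p X) ∘ z (T X) = z X ∘ p X ->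
  fmap T (p X) ∘ (z (T X) ∘ tan_pr t X (@ord_max 1)) = z X ∘ tan_base t 2 X.
Proof.
by move=> pz; rewrite compmA pz -compmA; congr (_ ∘ _);
   exact: (fp_comm (tan_fp t 0 2 X)).
Qed.

(* v = T(s) ∘ <l ∘ pr_1, z_T ∘ pr_2>, where the pairing is into T(T_2 X). *)
Definition tan_v (X : Y) (pl : fmap T (p X) ∘ l X = z X ∘ p X)
    (pz : fmap T (p X) ∘ z (T X) = z X ∘ p X) :
    hom (tan_Tn t 2 X) (T (T X)) :=
  fmap T (s X) ∘ fp_pair (tan_fp t 1 2 X) (tan_vert_l pl) (tan_vert_z pz).

Record is_tangent : Prop := {
  tan_additive : forall X, is_additive_bundle (tan_bundle X);
  (* Naturality of p, s and z. *)
  tan_nat : forall (X X' : Y) (f : hom X X'),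
    @is_bundle_morph (tan_bundle X) (tan_bundle X') (fmap T f) f;
  tan_l_nat : forall (X X' : Y) (f : hom X X'),
    fmap T (fmap T f) ∘ l X = l X' ∘ fmap T f;
  tan_c_nat : forall (X X' : Y) (f : hom X X'),
    fmap T (fmap T f) ∘ c X = c X' ∘ fmap T (fmap T f);
  tan_l_bundle : forall X,
    @is_bundle_morph (tan_bundle X) (tan_Tbundle X) (l X) (z X);
  tan_c_bundle : forall X,
    @is_bundle_morph (tan_Tbundle X) (tan_bundle (T X)) (c X) (1_ (T X));
  tan_cc : forall X, c X ∘ c X = 1_ (T (T X));
  tan_cl : forall X, c X ∘ l X = l X;
  tan_ll : forall X, fmap T (l X) ∘ l X = l (T X) ∘ l X;
  tan_ccc : forall X,
    fmap T (c X) ∘ c (T X) ∘ fmap T (c X) = c (T X) ∘ fmap T (c X) ∘ c (T X);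
  tan_ccl : forall X, c (T X) ∘ fmap T (c X) ∘ l (T X) = fmap T (l X) ∘ c X;
  (* k = 0: the square is a pullback; k > 0: T^k preserves it. *)
  tan_vert : forall k X,
    is_pullback
      (fmap (functor_pow T k) (fmap T (p X)))
      (fmap (functor_pow T k) (z X))
      (fmap (functor_pow T k)
         (tan_v (bm_p (tan_l_bundle X)) (bm_z (tan_nat (p X)))))
      (fmap (functor_pow T k) (p X ∘ tan_pr t X (@ord0 1))) }.

End TangentLaws.

Record TangentStructure := MkTangentStructure {
  tan_data :> TangentData;
  tan_ax : is_tangent tan_data }.

End Tangent.

(* Main.v *)
(* An S-algebra map [B -> A ⊕ A] into the square-zero extension of [A] is the same
   as an algebra map [f : B -> A] together with a derivation [B -> A] along [f],
   and likewise for module parts; so every structure map of the tangent category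
   is obtained from a morphism and a "vector" over it, built out of projections,
   sums and zeros. The chain rule D.4 makes [nu_flat] an algebra, the Leibniz rule
   D.2 identifies its multiplication with that of dual numbers, and the symmetry
   D.5 of second derivatives gives both the derivation law for [D ⊕ D] and the
   canonical flip. Fibre products and pullbacks in S-DER are created by the
   forgetful functor (A, M) to two copies of the base, where the tangent laws are
   matrix identities. *)
From mathcomp Require Import all_boot.
Require Import Defs.
Set Implicit Arguments.
Unset Strict Implicit.
Unset Printing Implicit Defensive.
Local Open Scope cat_scope.

(** * Coherence *)

Section Monoidal.
Variable X : SymMonCat.

(** Composites are kept left-nested, where [g ∘ f] is not a subterm of [k ∘ g ∘ f]; this form of the
    equation applies there. *)
Lemma comp_eqr (C : Category) (A B K L : C) (g : hom B K) (f : hom A B)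
    (h : hom A K) : g ∘ f = h -> forall k : hom K L, k ∘ g ∘ f = k ∘ h.
Proof. by move=> <- k; rewrite compmA. Qed.

Lemma comp_eqr3 (C : Category) (A B K L N : C) (g : hom B K) (f : hom A B)
    (e : hom N A) (h : hom N K) :
  g ∘ f ∘ e = h -> forall k : hom K L, k ∘ g ∘ f ∘ e = k ∘ h.
Proof. by move=> <- k; rewrite !compmA. Qed.

Lemma tens_comp (A B C A' B' C' : X) (g : hom B C) (f : hom A B)
    (g' : hom B' C') (f' : hom A' B') :
  (g ⊠ g') ∘ (f ⊠ f') = (g ∘ f) ⊠ (g' ∘ f').
Proof. by rewrite tensmM. Qed.

Lemma comp_tens_comp (A B C A' B' C' K : X) (g : hom B C) (f : hom A B)
    (g' : hom B' C') (f' : hom A' B') (k : hom (C ⊗ C') K) :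
  k ∘ (g ⊠ g') ∘ (f ⊠ f') = k ∘ ((g ∘ f) ⊠ (g' ∘ f')).
Proof. by rewrite tensmM compmA. Qed.

Lemma mluniti_nat (A B : X) (f : hom A B) :
  mluniti B ∘ f = (1_ munit ⊠ f) ∘ mluniti A.
Proof.
rewrite -[LHS]compm1 -(mlunitiK A) compmA -(compmA (mluniti B)) -mlunit_nat.
by rewrite compmA mlunitK comp1m.
Qed.

Lemma massoci_nat (A B C A' B' C' : X)
    (f : hom A A') (g : hom B B') (h : hom C C') :
  massoci A' B' C' ∘ (f ⊠ (g ⊠ h)) = ((f ⊠ g) ⊠ h) ∘ massoci A B C.
Proof.
rewrite -[LHS]compm1 -(massociK A B C) compmA -(compmA (massoci A' B' C')).
by rewrite -massoc_nat compmA massocK comp1m.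
Qed.

(** This is [mhexagon] at [B], [A], [C], solved for the middle swap that occurs in D.2 and D.5. *)
Lemma hexagoni (A B C : X) :
  (msym B A ⊠ 1_ C) ∘ massoci B A C ∘ msym (A ⊗ C) B
  = massoci A B C ∘ (1_ A ⊠ msym C B) ∘ massoc A C B.
Proof.
have hx := mhexagon B A C.
transitivity (massoci A B C ∘ (1_ A ⊠ msym C B)
    ∘ ((1_ A ⊠ msym B C) ∘ massoc A B C ∘ (msym B A ⊠ 1_ C))
    ∘ massoci B A C ∘ msym (A ⊗ C) B).
  rewrite !compmA comp_tens_comp comp1m msymK tensm1 compm1.
  by rewrite massocK comp1m.
rewrite -hx -!compmA; do 2 congr (_ ∘ _).
by rewrite (compmA (massoc B A C)) massociK comp1m msymK compm1.
Qed.
End Monoidal.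

(** * The chain rule *)

Section Dif.
Variables (X : AddSymMonCat) (S : DifferentialModality X).

Definition is_alg_mor (A B : X) (ν : hom (S A) A) (ν' : hom (S B) B)
  (f : hom A B) := f ∘ ν = ν' ∘ fmap S f.

Lemma alg_mor_m (A B : X) (ν : hom (S A) A) (ν' : hom (S B) B) (f : hom A B) :
  is_alg_mor ν ν' f -> f ∘ alg_m ν = alg_m ν' ∘ (f ⊠ f).
Proof.
move=> hf; rewrite /alg_m !compmA hf comp_tens_comp -!am_eta_nat.
by rewrite tensmM !compmA (comp_eqr (am_m_nat _ f)) !compmA.
Qed.

Lemma alg_mor_u (A B : X) (ν : hom (S A) A) (ν' : hom (S B) B) (f : hom A B) :
  is_alg_mor ν ν' f -> f ∘ alg_u ν = alg_u ν'.
Proof. by move=> hf; rewrite /alg_u compmA hf -compmA am_u_nat. Qed.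

(** * The commutative monoid of an algebra *)

Section Algebra.
Variables (A : X) (ν : hom (S A) A).
Hypothesis ν_alg : is_algebra ν.

(** Insert [am_mu ∘ am_eta = 1] on both factors, pull [am_mu] out through the multiplication, and
    trade it for [fmap S ν] by [algM]. *)
Lemma free_m : ν ∘ am_m S A = alg_m ν ∘ (ν ⊠ ν).
Proof.
rewrite -[LHS]compm1 -tensm1 -am_mu_eta tensmM compmA -(compmA ν) -am_mu_m.
rewrite compmA (algM ν_alg) -(compmA ν) am_m_nat !compmA comp_tens_comp.
by rewrite !am_eta_nat tensmM !compmA.
Qed.

(** By [free_m], each law is the law of [S A] composed with units [am_eta] on the inside and [ν] on
    the outside. *)
Lemma alg_monoid : is_comm_monoid (alg_m ν) (alg_u ν).
Proof.
have [mA m1 mC] := am_monoid S A.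
have mE : alg_m ν = ν ∘ am_m S A ∘ (am_eta S A ⊠ am_eta S A) by [].
have mν := free_m; move: (alg_m ν) mE mν => m mE mν.
split.
- have -> : m ∘ (1_ A ⊠ m)
     = ν ∘ am_m S A ∘ (1_ _ ⊠ am_m S A) ∘ (am_eta S A ⊠ am_eta S A ⊠ am_eta S A).
    by rewrite mν !comp_tens_comp !compmA compm1 (alg1 ν_alg) mE.
  have -> : m ∘ (m ⊠ 1_ A)
     = ν ∘ am_m S A ∘ (am_m S A ⊠ 1_ _) ∘ ((am_eta S A ⊠ am_eta S A) ⊠ am_eta S A).
    by rewrite mν !comp_tens_comp !compmA compm1 (alg1 ν_alg) mE.
  by rewrite -!compmA -massoc_nat !compmA (comp_eqr3 mA) !compmA.
- have -> : m ∘ (alg_u ν ⊠ 1_ A)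
     = ν ∘ am_m S A ∘ (am_u S A ⊠ 1_ _) ∘ (1_ _ ⊠ am_eta S A).
    by rewrite mν !comp_tens_comp !compmA !compm1 (alg1 ν_alg).
  by rewrite -!compmA -mluniti_nat !compmA (comp_eqr3 m1) compm1 (alg1 ν_alg).
- by rewrite mE -!compmA -msym_nat (compmA (am_m _ _)) mC.
Qed.
End Algebra.

(** With [free_m_monoid], this supplies the hypotheses [xu] and [xm] of the [dif] lemmas for the
    coefficient maps [ν ∘ fmap S f] of square-zero extensions. *)
Lemma free_u_monoid (B A : X) (ν : hom (S A) A) (f : hom B A) :
  ν ∘ fmap S f ∘ am_u S B = alg_u ν.
Proof. by rewrite -compmA am_u_nat. Qed.

Lemma free_m_monoid (B A : X) (ν : hom (S A) A) (f : hom B A) :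
  is_algebra ν ->
  ν ∘ fmap S f ∘ am_m S B = alg_m ν ∘ ((ν ∘ fmap S f) ⊠ (ν ∘ fmap S f)).
Proof.
by move=> hν; rewrite -compmA am_m_nat compmA (free_m hν) comp_tens_comp.
Qed.

(* [α ∘ (x ⊠ y) ∘ d]: the chain rule, with [x] evaluating the coefficients of
   the differential and [y] its directions. An S-derivation is a [D] with
   [D ∘ ν = dif α ν D], and [nu_flat ν] has second component
   [dif (alg_m ν) (ν ∘ S π1) π2]. *)
Definition dif (B A M : X) (α : hom (A ⊗ M) M) (x : hom (S B) A) (y : hom B M) :
  hom (S B) M := α ∘ (x ⊠ y) ∘ dm_d S B.

Lemma dif_fmap (C B A M : X) (α : hom (A ⊗ M) M) (x : hom (S B) A)
    (y : hom B M) (h : hom C B) :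
  dif α x y ∘ fmap S h = dif α (x ∘ fmap S h) (y ∘ h).
Proof. by rewrite /dif tensmM !compmA (comp_eqr (dm_d_nat S h)) !compmA. Qed.

Lemma comp_dif (B A M A' M' : X) (α : hom (A ⊗ M) M) (α' : hom (A' ⊗ M') M')
    (x : hom (S B) A) (y : hom B M) (f : hom A A') (g : hom M M') :
  g ∘ α = α' ∘ (f ⊠ g) -> g ∘ dif α x y = dif α' (f ∘ x) (g ∘ y).
Proof. by move=> e; rewrite /dif tensmM !compmA e. Qed.

Lemma difD (B A M : X) (α : hom (A ⊗ M) M) (x : hom (S B) A) (y y' : hom B M) :
  dif α x (y + y') = dif α x y + dif α x y'.
Proof. by rewrite /dif tensmDr compmDr compmDl. Qed.

Lemma dif0 (B A M : X) (α : hom (A ⊗ M) M) (x : hom (S B) A) :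
  dif α x (zerom B M) = 0.
Proof. by rewrite /dif tensm0 compm0 comp0m. Qed.

Lemma dif_u (B A M : X) (α : hom (A ⊗ M) M) (x : hom (S B) A) (y : hom B M) :
  dif α x y ∘ am_u S B = 0.
Proof. by rewrite /dif -compmA dm_d_u compm0. Qed.

(** * Differentials with values in a module *)

Section Module.
Variables (A M : X) (m : hom (A ⊗ A) A) (u : hom munit A) (α : hom (A ⊗ M) M).
Hypotheses (Am : is_comm_monoid m u) (Mm : is_module m u α).
Variables (B : X) (x : hom (S B) A).
Hypotheses (xm : x ∘ am_m S B = m ∘ (x ⊠ x)) (xu : x ∘ am_u S B = u).

Lemma modAi : α ∘ (m ⊠ 1_ M) ∘ massoci A A M = α ∘ (1_ A ⊠ α).
Proof. by rewrite -(modA Mm) -compmA massociK compm1. Qed.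

Lemma dif_eta (y : hom B M) : dif α x y ∘ am_eta S B = y.
Proof.
rewrite /dif -compmA dm_d_eta !compmA comp_tens_comp xu compm1.
rewrite -[u]compm1 -(comp1m y) tensmM compmA -compmA -mluniti_nat compmA.
by rewrite (mod1 Mm) comp1m.
Qed.

(** Both D.2 and D.4 end by multiplying coefficients. As [x] is multiplicative, acting by such a
    product is acting twice. *)
Lemma mod_mul (y : hom B M) :
  α ∘ (x ⊠ y) ∘ (am_m S B ⊠ 1_ B) ∘ massoci (S B) (S B) B
  = α ∘ (1_ A ⊠ α) ∘ (x ⊠ (x ⊠ y)).
Proof.
rewrite comp_tens_comp xm compm1.
have -> : (m ∘ (x ⊠ x)) ⊠ y = (m ⊠ 1_ M) ∘ ((x ⊠ x) ⊠ y).
  by rewrite tens_comp comp1m.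
by rewrite compmA -compmA -massoci_nat compmA modAi.
Qed.

Lemma dif_mu (y : hom B M) :
  dif α x y ∘ am_mu S B = dif α (x ∘ am_mu S B) (dif α x y).
Proof.
rewrite /dif -compmA dm_d_mu !compmA mod_mul !comp_tens_comp comp1m.
by rewrite compmA.
Qed.

(** The Leibniz rule D.2 restricted to generators; each summand then loses one differential by
    [dif_eta]. *)
Lemma dif_m (y : hom B M) :
  dif α x y ∘ am_m S B ∘ (am_eta S B ⊠ am_eta S B)
  = α ∘ ((x ∘ am_eta S B) ⊠ y) + α ∘ ((x ∘ am_eta S B) ⊠ y) ∘ msym B B.
Proof.
have e : α ∘ (x ⊠ y) ∘ (am_m S B ⊠ 1_ B) ∘ massoci (S B) (S B) B
    ∘ (1_ (S B) ⊠ dm_d S B) ∘ (am_eta S B ⊠ am_eta S B)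
    = α ∘ ((x ∘ am_eta S B) ⊠ y).
  rewrite mod_mul !comp_tens_comp !comp1m.
  by rewrite -[in RHS](dif_eta y) /dif !compmA.
rewrite -e /dif -(compmA (_ ∘ _) (dm_d S B)) dm_d_m.
rewrite !compmDr compmDl !compmA; congr (_ + _).
(* By [hexagoni], the reshuffling in the second summand of D.2 is a swap of the whole input followed
   by a swap of the two coefficients. Commutativity absorbs the latter, leaving the first summand
   precomposed with [msym B B]. *)
have mC := cmonC (am_monoid S B).
rewrite (comp_eqr3 (esym (hexagoni (S B) (S B) B))) !compmA.
rewrite -(compmA _ _ (msym (S B) (S B) ⊠ 1_ B)) tens_comp mC comp1m.
by rewrite -!compmA -!msym_nat (compmA (msym _ _)) msym_nat !compmA.
Qed.

(** Both sides are second derivatives contracted with the directions [y] and [w], differentiated in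
    opposite orders; D.5 makes them agree. *)
Lemma dif2 (y : hom B A) (w : hom B M) :
  α ∘ (y ⊠ dif α x w) ∘ msym (S B) B ∘ dm_d S B = dif α (dif m x y) w.
Proof.
have -> : α ∘ (y ⊠ dif α x w)
  = α ∘ (1_ A ⊠ α) ∘ (y ⊠ (x ⊠ w)) ∘ (1_ B ⊠ dm_d S B).
  by rewrite !comp_tens_comp compm1 comp1m /dif !compmA.
rewrite -modAi.
have e : (m ⊠ 1_ M) ∘ massoci A A M ∘ (y ⊠ (x ⊠ w))
  = (m ⊠ 1_ M) ∘ ((x ⊠ y) ⊠ w) ∘ (msym B (S B) ⊠ 1_ B) ∘ massoci B (S B) B.
  rewrite -compmA massoci_nat compmA !tens_comp !comp1m !compm1; congr (_ ∘ _).
  by rewrite -compmA -msym_nat compmA (cmonC Am).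
rewrite (comp_eqr3 e) -!compmA (compmA (1_ B ⊠ _)) -msym_nat.
rewrite !compmA -(compmA _ (massoci _ _ _)).
(* This is D.5, once [hexagoni] has turned the reshuffling into a swap of the two directions. *)
have h : (msym B (S B) ⊠ 1_ B) ∘ (massoci B (S B) B ∘ msym (S B ⊗ B) B)
    ∘ (dm_d S B ⊠ 1_ B) ∘ dm_d S B = (dm_d S B ⊠ 1_ B) ∘ dm_d S B.
  rewrite compmA hexagoni -!compmA.
  have := dm_d_d S B; rewrite -!compmA => ->.
  by rewrite !compmA massocK comp1m.
move: h; rewrite -!compmA => ->.
by rewrite /dif !compmA !comp_tens_comp comp1m compm1 !compmA.
Qed.

End Module.

(** Take [A] as a module over itself in [dif2]; commutativity of [m] exchanges its two factors. This
    is what makes the canonical flip an algebra morphism. *)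
Lemma dif_swap (A : X) (m : hom (A ⊗ A) A) (u : hom munit A)
    (B : X) (x : hom (S B) A) (y w : hom B A) :
  is_comm_monoid m u -> dif m (dif m x y) w = dif m (dif m x w) y.
Proof.
move=> Am; have [mA m1 mC] := Am.
have Mm : is_module m u m by split.
by rewrite -(dif2 Am Mm) -(compmA m) -msym_nat compmA mC.
Qed.

(** Since [der_D D ∘ der_nu D] is a [dif], this is [dif_m] with coefficient map [der_nu D] and
    direction [der_D D]. *)
Lemma derivation_m (D : DerData S) : is_Sderivation D ->
  der_D D ∘ alg_m (der_nu D)
  = der_alpha D ∘ (1_ _ ⊠ der_D D) + der_alpha D ∘ (1_ _ ⊠ der_D D) ∘ msym _ _.
Proof.
case=> hν hα hD; have xm := free_m hν; have xu : _ = alg_u (der_nu D) := erefl.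
have := dif_m hα xm xu (der_D D); rewrite (alg1 hν) => <-.
by rewrite /dif -hD /alg_m !compmA.
Qed.
End Dif.

(** * Square-zero extensions *)

Section Flat.
Variables (X : AddSymMonCat) (S : DifferentialModality X).
Variable BP : FiniteBiproducts X.
Local Notation "A ⊕ B" := (bip BP A B) (at level 36, right associativity).
Local Notation π1 := (bpi1 BP _ _).
Local Notation π2 := (bpi2 BP _ _).
Local Notation ι1 := (bin1 BP _ _).
Local Notation ι2 := (bin2 BP _ _).

Lemma bip_ext (A B C : X) (f g : hom C (A ⊕ B)) :
  π1 ∘ f = π1 ∘ g -> π2 ∘ f = π2 ∘ g -> f = g.
Proof.
by move=> e1 e2; rewrite -[f]comp1m -[g]comp1m -bip_sum !compmDl -!compmA e1 e2.
Qed.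

Lemma mrow10 (A B : X) : mrow BP (1_ A) (zerom B A) = π1.
Proof. by rewrite /mrow comp1m comp0m addm0. Qed.

Lemma mrow01 (A B : X) : mrow BP (zerom A B) (1_ B) = π2.
Proof. by rewrite /mrow comp1m comp0m add0m. Qed.

(** From here on the flat structures are handled through their two projections: the first is the
    original structure, the second its linearisation. *)
Lemma pi1_nu_flat (A : X) (ν : hom (S A) A) :
  π1 ∘ nu_flat BP ν = ν ∘ fmap S π1.
Proof. by rewrite pi1_col mrow10. Qed.

Lemma pi2_nu_flat (A : X) (ν : hom (S A) A) :
  π2 ∘ nu_flat BP ν = dif (alg_m ν) (ν ∘ fmap S π1) π2.
Proof. by rewrite pi2_col mrow10 mrow01 comp_tens_comp comp1m. Qed.

Lemma pi1_alpha_flat (A M : X) (α : hom (A ⊗ M) M) :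
  π1 ∘ alpha_flat BP α = α ∘ (π1 ⊠ π1).
Proof.
rewrite /alpha_flat compmA pi1_col /distr !mrow_col.
by rewrite !comp0m !addm0.
Qed.

Lemma pi2_alpha_flat (A M : X) (α : hom (A ⊗ M) M) :
  π2 ∘ alpha_flat BP α = α ∘ (π1 ⊠ π2) + α ∘ (π2 ⊠ π1).
Proof.
rewrite /alpha_flat compmA pi2_col /distr !mrow_col.
by rewrite !comp0m !addm0 !add0m.
Qed.

Lemma pi1_D_flat (A M : X) (D : hom A M) : π1 ∘ D_flat BP D = D ∘ π1.
Proof. by rewrite pi1_col /mrow comp0m addm0. Qed.

Lemma pi2_D_flat (A M : X) (D : hom A M) : π2 ∘ D_flat BP D = D ∘ π2.
Proof. by rewrite pi2_col /mrow comp0m add0m. Qed.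

Lemma pi1_dif_flat (B A M : X) (α : hom (A ⊗ M) M) (x : hom (S B) (A ⊕ A))
    (y : hom B (M ⊕ M)) :
  π1 ∘ dif (alpha_flat BP α) x y = dif α (π1 ∘ x) (π1 ∘ y).
Proof. exact: comp_dif (pi1_alpha_flat α). Qed.

Lemma pi2_dif_flat (B A M : X) (α : hom (A ⊗ M) M) (x : hom (S B) (A ⊕ A))
    (y : hom B (M ⊕ M)) :
  π2 ∘ dif (alpha_flat BP α) x y
  = dif α (π1 ∘ x) (π2 ∘ y) + dif α (π2 ∘ x) (π1 ∘ y).
Proof.
have := pi2_alpha_flat α; move: (alpha_flat BP α) => α' e.
by rewrite /dif !compmA e !compmDl -!(compmA α) !tens_comp.
Qed.

(** The law [modA] on generalized elements, the shape it takes once components of a flat structure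
    have been substituted. *)
Lemma mod_tens (A M : X) (m : hom (A ⊗ A) A) (u : hom munit A)
    (α : hom (A ⊗ M) M) (P Q R : X) (p : hom P A) (q : hom Q A) (r : hom R M) :
  is_module m u α ->
  α ∘ (p ⊠ (α ∘ (q ⊠ r))) ∘ massoc P Q R = α ∘ ((m ∘ (p ⊠ q)) ⊠ r).
Proof.
move=> hα; have -> : (m ∘ (p ⊠ q)) ⊠ r = (m ⊠ 1_ M) ∘ ((p ⊠ q) ⊠ r).
  by rewrite tens_comp comp1m.
rewrite compmA -(modA hα) -[in RHS]compmA massoc_nat compmA comp_tens_comp.
by rewrite comp1m.
Qed.

Lemma mod_unit (A M : X) (m : hom (A ⊗ A) A) (u : hom munit A)
    (α : hom (A ⊗ M) M) (R : X) (r : hom R M) :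
  is_module m u α -> α ∘ (u ⊠ r) ∘ mluniti R = r.
Proof.
move=> hα; rewrite -[u]compm1 -[r]comp1m tensmM compmA -compmA -mluniti_nat.
by rewrite compmA (mod1 hα) comp1m.
Qed.

(** * The algebra of dual numbers *)

Section FlatAlgebra.
Variables (A : X) (ν : hom (S A) A).
Hypothesis hν : is_algebra ν.
Let mν := alg_monoid hν.
Let xm B (f : hom B A) := free_m_monoid f hν.
Let xu B (f : hom B A) := free_u_monoid ν f.

Lemma alg_self_module : is_module (alg_m ν) (alg_u ν) (alg_m ν).
Proof. by split; [exact: cmonA mν | exact: cmon1 mν]. Qed.

(** The first components are the laws of [ν] carried along [π1]. The second ones are [dif_eta] for
    the unit and [dif_mu] for associativity. *)
Lemma nu_flat_alg : is_algebra (nu_flat BP ν).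
Proof.
have hm := alg_self_module.
split; apply: bip_ext; rewrite !compmA.
- by rewrite pi1_nu_flat -compmA am_eta_nat compmA (alg1 hν) comp1m compm1.
- by rewrite pi2_nu_flat (dif_eta hm (xu _)) compm1.
- rewrite pi1_nu_flat -compmA am_mu_nat compmA (algM hν) -!compmA -!fmapM.
  by rewrite pi1_nu_flat.
- rewrite pi2_nu_flat (dif_mu hm (xm _)) dif_fmap -pi2_nu_flat; congr dif.
  rewrite -compmA am_mu_nat compmA (algM hν) -!compmA -!fmapM.
  by rewrite pi1_nu_flat.
Qed.

(** The second component is [dif_m], whose swapped summand is straightened by commutativity. *)
Lemma alg_m_flat : alg_m (nu_flat BP ν) = alpha_flat BP (alg_m ν).
Proof.
have hm := alg_self_module.
have e : ν ∘ fmap S π1 ∘ am_eta S (A ⊕ A) = π1.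
  by rewrite -compmA am_eta_nat compmA (alg1 hν) comp1m.
have := pi1_alpha_flat (alg_m ν); have := pi2_alpha_flat (alg_m ν).
move: (alpha_flat BP (alg_m ν)) => α' e2 e1.
apply: bip_ext; rewrite {1}/alg_m !compmA.
- by rewrite pi1_nu_flat xm comp_tens_comp e e1.
- rewrite pi2_nu_flat (dif_m hm (xm _) (xu _)) e e2.
  by rewrite -compmA -msym_nat compmA (cmonC mν).
Qed.

Lemma pi1_alg_u_flat : π1 ∘ alg_u (nu_flat BP ν) = alg_u ν.
Proof. by rewrite /alg_u compmA pi1_nu_flat -compmA am_u_nat. Qed.

Lemma pi2_alg_u_flat : π2 ∘ alg_u (nu_flat BP ν) = 0.
Proof. by rewrite /alg_u compmA pi2_nu_flat dif_u. Qed.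
End FlatAlgebra.

(** In the second component of associativity, both sides sum over which of the three factors
    contributes its vertical part, and [mod_tens] matches the summands. *)
Lemma flat_module (A M : X) (m : hom (A ⊗ A) A) (u : hom munit A)
    (α : hom (A ⊗ M) M) (m' : hom ((A ⊕ A) ⊗ (A ⊕ A)) (A ⊕ A))
    (u' : hom munit (A ⊕ A)) (α' : hom ((A ⊕ A) ⊗ (M ⊕ M)) (M ⊕ M)) :
  is_module m u α ->
  π1 ∘ m' = m ∘ (π1 ⊠ π1) -> π2 ∘ m' = m ∘ (π1 ⊠ π2) + m ∘ (π2 ⊠ π1) ->
  π1 ∘ u' = u -> π2 ∘ u' = 0 ->
  π1 ∘ α' = α ∘ (π1 ⊠ π1) -> π2 ∘ α' = α ∘ (π1 ⊠ π2) + α ∘ (π2 ⊠ π1) ->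
  is_module m' u' α'.
Proof.
move=> hα m1 m2 u1 u2 a1 a2; split; apply: bip_ext; rewrite !compmA ?a1 ?a2.
- by rewrite !comp_tens_comp !compm1 a1 m1 (mod_tens _ _ _ hα).
- rewrite !compmDl !comp_tens_comp !compm1 a1 a2 m1 m2 tensmDl tensmDr.
  by rewrite !compmDr compmDl !(mod_tens _ _ _ hα) addmA.
- by rewrite comp_tens_comp u1 !compm1 (mod_unit _ hα).
- rewrite !compmDl !comp_tens_comp u1 u2 !compm1.
  by rewrite tens0m compm0 comp0m addm0 (mod_unit _ hα).
Qed.

(** In the second component, [D] meets the product inside [dif]. Of the two Leibniz terms, one
    applies [D] to the coefficient, giving a second derivative in the opposite order to the one
    required; [dif2] reconciles them. *)
Lemma flat_derivation (D : DerData S) : is_Sderivation D ->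
  is_derivation (nu_flat BP (der_nu D)) (alpha_flat BP (der_alpha D))
    (D_flat BP (der_D D)).
Proof.
move=> hD; have [hν hα hd] := hD; have hm := derivation_m hD.
case: D {hD} => A ν M α D /= in hν hα hd hm *.
rewrite /is_derivation -/(dif _ _ _); apply: bip_ext.
- rewrite pi1_dif_flat pi1_D_flat pi1_nu_flat compmA pi1_D_flat.
  by rewrite -compmA pi1_nu_flat compmA hd -/(dif _ _ _) dif_fmap.
- rewrite pi2_dif_flat pi1_D_flat pi2_D_flat pi1_nu_flat compmA pi2_D_flat.
  rewrite -compmA pi2_nu_flat.
  have hx : D ∘ (ν ∘ fmap S (bpi1 BP A A)) = dif α (ν ∘ fmap S π1) (D ∘ π1).
    by rewrite compmA hd -/(dif _ _ _) dif_fmap.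
  rewrite -(dif2 (alg_monoid hν) hα) -hx.
  move: (alg_m ν) hm => m hm.
  rewrite /dif !compmA hm !compmDl !comp_tens_comp !comp1m; congr (_ + _).
  by rewrite -!compmA (compmA (msym _ _)) msym_nat !compmA comp_tens_comp comp1m
     !compmA.
Qed.

Lemma der_flat_ax (D : DerData S) :
  is_Sderivation D -> is_Sderivation (der_flat BP D).
Proof.
move=> hD; have [hν hα _] := hD.
split; [exact: nu_flat_alg | | exact: flat_derivation].
apply: flat_module hα _ _ _ _ _ _; rewrite ?alg_m_flat //.
- exact: pi1_alpha_flat.
- exact: pi2_alpha_flat.
- exact: pi1_alg_u_flat.
- exact: pi2_alg_u_flat.
- exact: pi1_alpha_flat.
- exact: pi2_alpha_flat.
Qed.

Lemma flat_alg_mor (B A : X) (β : hom (S B) B) (ν : hom (S A) A)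
    (h : hom B (A ⊕ A)) :
  is_alg_mor β ν (π1 ∘ h) ->
  π2 ∘ h ∘ β = dif (alg_m ν) (ν ∘ fmap S (π1 ∘ h)) (π2 ∘ h) ->
  is_alg_mor β (nu_flat BP ν) h.
Proof.
move=> h1 h2; apply: bip_ext; rewrite !compmA.
- by rewrite h1 pi1_nu_flat fmapM compmA.
- by rewrite h2 pi2_nu_flat dif_fmap fmapM compmA.
Qed.

Lemma flat_mod_mor (B N A M : X) (β : hom (B ⊗ N) N) (α : hom (A ⊗ M) M)
    (f : hom B (A ⊕ A)) (g : hom N (M ⊕ M)) :
  π1 ∘ g ∘ β = α ∘ ((π1 ∘ f) ⊠ (π1 ∘ g)) ->
  π2 ∘ g ∘ β = α ∘ ((π1 ∘ f) ⊠ (π2 ∘ g)) + α ∘ ((π2 ∘ f) ⊠ (π1 ∘ g)) ->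
  g ∘ β = alpha_flat BP α ∘ (f ⊠ g).
Proof.
move=> e1 e2; have := pi2_alpha_flat α; have := pi1_alpha_flat α.
move: (alpha_flat BP α) => α' a1 a2; apply: bip_ext; rewrite !compmA.
- by rewrite e1 a1 comp_tens_comp.
- by rewrite e2 a2 compmDl !comp_tens_comp.
Qed.
End Flat.

(** * The tangent structure of biproducts *)

Section BiproductTangent.
Variables (X : AddSymMonCat) (BP : FiniteBiproducts X).
Local Notation "A ⊕ B" := (bip BP A B) (at level 36, right associativity).
Local Notation π1 := (bpi1 BP _ _).
Local Notation π2 := (bpi2 BP _ _).
Local Notation ι1 := (bin1 BP _ _).
Local Notation ι2 := (bin2 BP _ _).
Local Notation F := (D_flat BP).

(** * Fibre powers of the projection *)

Fixpoint pow (A : X) (n : nat) : X :=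
  if n is n'.+1 then A ⊕ pow A n' else bzero BP.

Fixpoint pow_pr (A : X) (n : nat) : 'I_n -> hom (pow A n) A :=
  match n return 'I_n -> hom (pow A n) A with
  | 0 => fun=> 0
  | n'.+1 => fun i =>
    if unlift ord0 i is Some j then pow_pr A j ∘ π2 else π1
  end.

Fixpoint pow_tuple (A Z : X) (n : nat) :
    ('I_n -> hom Z A) -> hom Z (pow A n) :=
  match n return ('I_n -> hom Z A) -> hom Z (pow A n) with
  | 0 => fun=> 0
  | n'.+1 => fun a => mcol BP (a ord0) (pow_tuple (fun j => a (lift ord0 j)))
  end.

Lemma pow_pr_tuple (A Z : X) (n : nat) (a : 'I_n -> hom Z A) i :
  pow_pr A i ∘ pow_tuple a = a i.
Proof.
elim: n a i => [|n IH] a i; first by case: i.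
rewrite /=; case: unliftP => [j|] ->; last by rewrite pi1_col.
by rewrite -compmA pi2_col IH.
Qed.

Lemma pow_ext (A Z : X) (n : nat) (h k : hom Z (pow A n)) :
  (forall i, pow_pr A i ∘ h = pow_pr A i ∘ k) -> h = k.
Proof.
elim: n h k => [|n IH] /= h k e.
  by rewrite (bzero_terminal h) (bzero_terminal k).
apply: bip_ext; first by have := e ord0; rewrite unlift_none.
by apply: IH => i; have := e (lift ord0 i); rewrite liftK !compmA.
Qed.

(** One base point and [n] vertical parts. For [n = 1] this is only isomorphic to [A ⊕ A], since
    [pow] ends in [bzero]. *)
Definition tpow (n : nat) (A : X) : X := A ⊕ pow A n.
Definition tpow_base (n : nat) (A : X) : hom (tpow n A) A := π1.
Definition tpow_pr (n : nat) (A : X) (i : 'I_n) : hom (tpow n A) (A ⊕ A) :=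
  mcol BP π1 (pow_pr A i ∘ π2).

Definition tpow_fp (n : nat) (A : X) :
  FibrePower (bpi1 BP A A) (tpow_base n A) (@tpow_pr n A).
Proof.
refine (@MkFibrePower X n _ _ _ _ _ _ _
  (fun Z b a _ => mcol BP b (pow_tuple (fun i => π2 ∘ a i))) _ _ _).
- by move=> i; rewrite pi1_col.
- by move=> Z b a _; rewrite pi1_col.
- move=> Z b a pa i; rewrite /tpow_pr mcol_comp; apply: bip_ext.
    by rewrite !pi1_col pa.
  by rewrite !pi2_col -compmA pi2_col pow_pr_tuple.
- move=> Z h k e1 e2; apply: bip_ext => //; apply: pow_ext => i.
  by have := congr1 (compm π2) (e2 i); rewrite !compmA !pi2_col.
Defined.

(** The diagonal matrix [D_flat], here [F], doubles as the action on maps of the tangent functor, on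
    the algebra and on the module component alike. *)
Lemma F_comp (A B C : X) (g : hom B C) (f : hom A B) : F (g ∘ f) = F g ∘ F f.
Proof.
apply: bip_ext; rewrite compmA.
- by rewrite !pi1_D_flat -(compmA g f) -pi1_D_flat compmA.
- by rewrite !pi2_D_flat -(compmA g f) -pi2_D_flat compmA.
Qed.

Lemma F_id (A : X) : F (1_ A) = 1_ _.
Proof.
by apply: bip_ext; rewrite ?pi1_D_flat ?pi2_D_flat comp1m compm1.
Qed.

(** A map [F f] is two independent copies of [f], so lifts are found copy by copy. Iteration gives
    preservation by every power of the tangent functor; [F_pullback] is alike. *)
Definition F_fp (n : nat) (E A P : X) (p : hom E A) (base : hom P A)
    (pr : 'I_n -> hom P E) :
  FibrePower p base pr -> FibrePower (F p) (F base) (fun i => F (pr i)).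
Proof.
move=> [pc lift lb lp lu].
have pa1 Z (b : hom Z (A ⊕ A)) (a : 'I_n -> hom Z (E ⊕ E)) :
    (forall i, F p ∘ a i = b) -> forall i, p ∘ (π1 ∘ a i) = π1 ∘ b.
  by move=> pa i; rewrite -(pa i) !compmA pi1_D_flat.
have pa2 Z (b : hom Z (A ⊕ A)) (a : 'I_n -> hom Z (E ⊕ E)) :
    (forall i, F p ∘ a i = b) -> forall i, p ∘ (π2 ∘ a i) = π2 ∘ b.
  by move=> pa i; rewrite -(pa i) !compmA pi2_D_flat.
refine (@MkFibrePower X n _ _ _ _ _ _ _
  (fun Z b a pa => mcol BP (lift _ _ _ (pa1 Z b a pa)) (lift _ _ _ (pa2 Z b a pa)))
  _ _ _).
- by move=> i; rewrite -F_comp pc.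
- move=> Z b a pa; apply: bip_ext; rewrite compmA.
    by rewrite pi1_D_flat -compmA pi1_col lb.
  by rewrite pi2_D_flat -compmA pi2_col lb.
- move=> Z b a pa i; apply: bip_ext; rewrite compmA.
    by rewrite pi1_D_flat -compmA pi1_col lp.
  by rewrite pi2_D_flat -compmA pi2_col lp.
- move=> Z h k e1 e2; apply: bip_ext; apply: lu => [|i]; rewrite !compmA.
  + by rewrite -pi1_D_flat -!compmA e1.
  + by rewrite -pi1_D_flat -!compmA e2.
  + by rewrite -pi2_D_flat -!compmA e1.
  + by rewrite -pi2_D_flat -!compmA e2.
Defined.

Lemma F_pullback (A B C P : X) (f : hom A C) (g : hom B C)
    (p1 : hom P A) (p2 : hom P B) :
  is_pullback f g p1 p2 -> is_pullback (F f) (F g) (F p1) (F p2).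
Proof.
move=> [pc pu]; split; first by rewrite -!F_comp pc.
move=> Z a b e.
have e1 : f ∘ (π1 ∘ a) = g ∘ (π1 ∘ b).
  by rewrite !compmA -!pi1_D_flat -!compmA e.
have e2 : f ∘ (π2 ∘ a) = g ∘ (π2 ∘ b).
  by rewrite !compmA -!pi2_D_flat -!compmA e.
have [h1 [[h1a h1b] u1]] := pu _ _ _ e1.
have [h2 [[h2a h2b] u2]] := pu _ _ _ e2.
exists (mcol BP h1 h2); split.
  by split; apply: bip_ext;
     rewrite compmA ?pi1_D_flat ?pi2_D_flat -compmA ?pi1_col ?pi2_col.
move=> k [ka kb]; apply: bip_ext; rewrite ?pi1_col ?pi2_col.
  by apply: u1; rewrite !compmA -!pi1_D_flat -!compmA ka kb.
by apply: u2; rewrite !compmA -!pi2_D_flat -!compmA ka kb.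
Qed.

(** * Zero, lift, flip and sum as matrices *)

Definition tz (A : X) : hom A (A ⊕ A) := mcol BP (1_ A) 0.
Definition tl (A : X) : hom (A ⊕ A) ((A ⊕ A) ⊕ (A ⊕ A)) :=
  mcol BP (mcol BP π1 0) (mcol BP 0 π2).
(** Transposition of a two by two array: [((a, b), (c, d))] goes to [((a, c), (b, d))]. *)
Definition tc (A : X) : hom ((A ⊕ A) ⊕ (A ⊕ A)) ((A ⊕ A) ⊕ (A ⊕ A)) :=
  mcol BP (F π1) (F π2).
Definition ts (A : X) : hom (tpow 2 A) (A ⊕ A) :=
  mcol BP π1 (π2 ∘ tpow_pr A (@ord0 1) + π2 ∘ tpow_pr A (@ord_max 1)).

(** Computes a sum from the projections of [h] alone, so that lifts into fibre powers need not be
    unfolded. *)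
Lemma ts_comp (A Z : X) (h : hom Z (tpow 2 A)) b x y :
  tpow_base 2 A ∘ h = b -> tpow_pr A (@ord0 1) ∘ h = x ->
  tpow_pr A (@ord_max 1) ∘ h = y -> ts A ∘ h = mcol BP b (π2 ∘ x + π2 ∘ y).
Proof. by move=> <- <- <-; rewrite /ts mcol_comp compmDl !compmA. Qed.

Lemma F_ts_comp (A Z : X) (h : hom Z (tpow 2 A ⊕ tpow 2 A)) b x y :
  F (tpow_base 2 A) ∘ h = b -> F (tpow_pr A (@ord0 1)) ∘ h = x ->
  F (tpow_pr A (@ord_max 1)) ∘ h = y ->
  F (ts A) ∘ h = mcol BP (mcol BP (π1 ∘ b) (π2 ∘ π1 ∘ x + π2 ∘ π1 ∘ y))
                         (mcol BP (π2 ∘ b) (π2 ∘ π2 ∘ x + π2 ∘ π2 ∘ y)).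
Proof.
move=> <- <- <-; apply: bip_ext; rewrite !compmA ?pi1_D_flat ?pi2_D_flat -compmA.
  rewrite (ts_comp erefl erefl erefl) pi1_col; congr (mcol _ _ (_ + _));
  by rewrite !compmA ?(comp_eqr (pi1_D_flat _ _)) ?compmA.
rewrite (ts_comp erefl erefl erefl) pi2_col; congr (mcol _ _ (_ + _));
by rewrite !compmA ?(comp_eqr (pi2_D_flat _ _)) ?compmA.
Qed.

(** Projections are pushed inwards through [F] until they meet a column and select an entry.
    [bip_eq] first splits an equation into all its coordinates. *)
Ltac bip_simpl :=
  rewrite ?compmA; repeat progress (
    repeat progress rewrite ?pi1_D_flat ?pi2_D_flat ?(comp_eqr (pi1_D_flat _ _))
      ?(comp_eqr (pi2_D_flat _ _)) ?compmA ?comp1m ?compm1 ?comp0m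
      ?compm0 ?addm0 ?add0m;
    first [rewrite 1!pi1_col | rewrite 1!pi2_col | rewrite 1!(comp_eqr (pi1_col _ _ _))
          | rewrite 1!(comp_eqr (pi2_col _ _ _)) | idtac]).
Ltac bip_eq := rewrite /tz /tl /tc /ts; repeat apply: bip_ext;
  repeat (bip_simpl; first [rewrite 1!compmDr | rewrite 1!compmDl]);
  bip_simpl; try by [].

Lemma tz_nat (A B : X) (f : hom A B) : F f ∘ tz A = tz B ∘ f.
Proof. by bip_eq. Qed.

Lemma tl_nat (A B : X) (f : hom A B) : F (F f) ∘ tl A = tl B ∘ F f.
Proof. by bip_eq. Qed.

Lemma tc_nat (A B : X) (f : hom A B) : F (F f) ∘ tc A = tc B ∘ F (F f).
Proof. by bip_eq. Qed.

Lemma p_tz (A : X) : π1 ∘ tz A = 1_ A.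
Proof. by bip_eq. Qed.

Lemma Fp_tl (A : X) : F π1 ∘ tl A = tz A ∘ π1.
Proof. by bip_eq. Qed.

Lemma p_tc (A : X) : π1 ∘ tc A = 1_ _ ∘ F π1.
Proof. by bip_eq. Qed.

Lemma tl_tz (A : X) : tl A ∘ tz A = F (tz A) ∘ tz A.
Proof. by bip_eq. Qed.

Lemma tc_Ftz (A : X) : tc A ∘ F (tz A) = tz (A ⊕ A) ∘ 1_ _.
Proof. by bip_eq. Qed.

Lemma tc_tc (A : X) : tc A ∘ tc A = 1_ _.
Proof. by bip_eq. Qed.

Lemma tc_tl (A : X) : tc A ∘ tl A = tl A.
Proof. by bip_eq. Qed.

Lemma tl_tl (A : X) : F (tl A) ∘ tl A = tl (A ⊕ A) ∘ tl A.
Proof. by bip_eq. Qed.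

Lemma tc_tc_tc (A : X) :
  F (tc A) ∘ tc (A ⊕ A) ∘ F (tc A) = tc (A ⊕ A) ∘ F (tc A) ∘ tc (A ⊕ A).
Proof. by bip_eq. Qed.

Lemma tc_tc_tl (A : X) : tc (A ⊕ A) ∘ F (tc A) ∘ tl (A ⊕ A) = F (tl A) ∘ tc A.
Proof. by bip_eq. Qed.

(** The right-hand sides here and in [tl_ts] and [tc_F_ts] have the shape that [ts_comp] or
    [F_ts_comp] gives to a sum after a lift, so compatibility with addition follows by
    transitivity. *)
Lemma F_ts (A B : X) (f : hom A B) :
  F f ∘ ts A = mcol BP (f ∘ π1) (π2 ∘ (F f ∘ tpow_pr A (@ord0 1))
                                 + π2 ∘ (F f ∘ tpow_pr A (@ord_max 1))).
Proof. by bip_eq. Qed.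

Lemma tl_ts (A : X) : tl A ∘ ts A =
  let x := tl A ∘ tpow_pr A (@ord0 1) in let y := tl A ∘ tpow_pr A (@ord_max 1) in
  mcol BP (mcol BP (π1 ∘ (tz A ∘ π1)) (π2 ∘ π1 ∘ x + π2 ∘ π1 ∘ y))
          (mcol BP (π2 ∘ (tz A ∘ π1)) (π2 ∘ π2 ∘ x + π2 ∘ π2 ∘ y)).
Proof. by rewrite /=; bip_eq. Qed.

Lemma tc_F_ts (A : X) : tc A ∘ F (ts A) =
  mcol BP (1_ _ ∘ F π1) (π2 ∘ (tc A ∘ F (tpow_pr A (@ord0 1)))
                         + π2 ∘ (tc A ∘ F (tpow_pr A (@ord_max 1)))).
Proof. by bip_eq. Qed.

(** The left side is what [F_ts_comp] gives for [tan_v]; in coordinates it sends [(a; v, w)] to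
    [((a, w), (0, v))]. *)
Lemma tvE (A : X) :
  let x := tl A ∘ tpow_pr A (@ord0 1) in
  let y := tz (A ⊕ A) ∘ tpow_pr A (@ord_max 1) in
  mcol BP (mcol BP (π1 ∘ (tz A ∘ π1)) (π2 ∘ π1 ∘ x + π2 ∘ π1 ∘ y))
          (mcol BP (π2 ∘ (tz A ∘ π1)) (π2 ∘ π2 ∘ x + π2 ∘ π2 ∘ y)) =
  mcol BP (mcol BP π1 (π2 ∘ tpow_pr A (@ord_max 1)))
          (mcol BP 0 (π2 ∘ tpow_pr A (@ord0 1))).
Proof. by rewrite /=; bip_eq. Qed.

(** Commutation of the square pins two of the four coordinates of [a], to [b] and to zero; the other
    two are free and serve as the two vertical parts. *)
Lemma tv_pullback (A : X) (v : hom (tpow 2 A) ((A ⊕ A) ⊕ (A ⊕ A))) :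
  v = mcol BP (mcol BP π1 (π2 ∘ tpow_pr A (@ord_max 1)))
              (mcol BP 0 (π2 ∘ tpow_pr A (@ord0 1))) ->
  is_pullback (F π1) (tz A) v (π1 ∘ tpow_pr A (@ord0 1)).
Proof.
move=> ->; split; first by rewrite /tpow_pr; bip_eq.
move=> Z a b e.
have e1 : π1 ∘ π1 ∘ a = b.
  have := congr1 (compm π1) e; rewrite /tz; bip_simpl; exact.
have e2 : π1 ∘ π2 ∘ a = 0.
  have := congr1 (compm π2) e; rewrite /tz; bip_simpl; exact.
(* The map [v] puts its first vertical part in the last coordinate and its second in coordinate
   [π2 ∘ π1], hence this order. *)
exists (mcol BP b (pow_tuple (fam2 (Y := X) (π2 ∘ π2 ∘ a) (π2 ∘ π1 ∘ a)))).
split; first split.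
- repeat apply: bip_ext; rewrite /tpow_pr; bip_simpl; rewrite ?e1 ?e2 //;
  by rewrite pow_pr_tuple /fam2 /=.
- by rewrite /tpow_pr; bip_simpl.
- move=> k [ka kb]; apply: bip_ext.
    by rewrite pi1_col -kb /tpow_pr; bip_simpl.
  rewrite pi2_col; apply: pow_ext => i; rewrite pow_pr_tuple -ka.
  have : i = ord0 \/ i = ord_max.
    by case: i => [[|[|//]]] ?; [left | right]; apply: val_inj.
  by case=> ->; rewrite /fam2 /tpow_pr /=; bip_simpl.
Qed.
End BiproductTangent.

(** * Morphisms of S-derivations *)

Section DerivationMorphisms.
Variables (X : AddSymMonCat) (S : DifferentialModality X).
Implicit Types P Q D E : DerData S.

(** The laws of [DerMor] on bare data, available before the source is known to satisfy the
    derivation axioms. *)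
Record is_der_mor P D (f : hom (der_A P) (der_A D)) (g : hom (der_M P) (der_M D)) :
    Prop := {
  der_mor_alg : is_alg_mor (der_nu P) (der_nu D) f;
  der_mor_mod : g ∘ der_alpha P = der_alpha D ∘ (f ⊠ g);
  der_mor_der : g ∘ der_D P = der_D D ∘ f }.

(* [(δ, ε)] is the vertical part of a morphism [P -> T D] lying over [(f, g)]. *)
Record is_vector P D (f : hom (der_A P) (der_A D)) (g : hom (der_M P) (der_M D))
    (δ : hom (der_A P) (der_A D)) (ε : hom (der_M P) (der_M D)) : Prop := {
  vec_alg : δ ∘ der_nu P = dif (alg_m (der_nu D)) (der_nu D ∘ fmap S f) δ;
  vec_mod : ε ∘ der_alpha P = der_alpha D ∘ (f ⊠ ε) + der_alpha D ∘ (δ ⊠ g);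
  vec_der : ε ∘ der_D P = der_D D ∘ δ }.

Lemma addmACA (A B : X) (f g h k : hom A B) : f + g + (h + k) = f + h + (g + k).
Proof. by rewrite -!addmA (addmA g) (addmC g h) addmA -addmA (addmA h). Qed.

Lemma der_mor_comp P Q D f g h k :
  @is_der_mor P Q f g -> @is_der_mor Q D h k -> is_der_mor (h ∘ f) (k ∘ g).
Proof.
case=> a1 a2 a3 [b1 b2 b3]; split.
- by rewrite /is_alg_mor fmapM -compmA a1 !compmA b1.
- by rewrite tensmM -compmA a2 !compmA b2.
- by rewrite -compmA a3 !compmA b3.
Qed.

Lemma der_mor_id P : @is_der_mor P P (1_ _) (1_ _).
Proof. by split; rewrite ?/is_alg_mor ?fmap1 ?tensm1 comp1m compm1. Qed.

(** Closure of vectors under zero, sums and composition on either side is what produces the zero,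
    sum and functorial maps of the tangent structure. *)
Lemma vector0 P D f g : @is_der_mor P D f g -> is_vector f g 0 0.
Proof.
case=> a1 a2 a3; split; first by rewrite comp0m dif0.
- by rewrite tensm0 tens0m !compm0 comp0m addm0.
- by rewrite comp0m compm0.
Qed.

Lemma vectorD P D f g δ ε δ' ε' : @is_vector P D f g δ ε ->
  @is_vector P D f g δ' ε' -> is_vector f g (δ + δ') (ε + ε').
Proof.
case=> a1 a2 a3 [b1 b2 b3]; split.
- by rewrite compmDl difD a1 b1.
- rewrite compmDl a2 b2 tensmDr tensmDl !compmDr; exact: addmACA.
- by rewrite compmDl compmDr a3 b3.
Qed.

Lemma vector_comp P Q D f g δ ε h k : @is_der_mor P Q f g ->
  @is_vector Q D h k δ ε -> is_vector (h ∘ f) (k ∘ g) (δ ∘ f) (ε ∘ g).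
Proof.
case=> a1 a2 a3 [b1 b2 b3]; split.
- by rewrite -compmA a1 compmA b1 dif_fmap fmapM !compmA.
- by rewrite -compmA a2 compmA b2 compmDl !comp_tens_comp.
- by rewrite -compmA a3 !compmA b3.
Qed.

Lemma comp_vector P Q D f g δ ε h k : @is_vector P Q f g δ ε ->
  @is_der_mor Q D h k -> is_vector (h ∘ f) (k ∘ g) (h ∘ δ) (k ∘ ε).
Proof.
case=> a1 a2 a3 [b1 b2 b3]; split.
- rewrite -compmA a1 (comp_dif _ _ (alg_mor_m b1)) fmapM.
  by congr dif; rewrite !compmA b1.
- by rewrite -compmA a2 compmDr !compmA b2 !comp_tens_comp.
- by rewrite -compmA a3 !compmA b3.
Qed.

(** * Structure maps as derivation morphisms *)

Section Flat.
Variable BP : FiniteBiproducts X.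
Local Notation "A ⊕ B" := (bip BP A B) (at level 36, right associativity).
Local Notation π1 := (bpi1 BP _ _).
Local Notation π2 := (bpi2 BP _ _).
Local Notation F := (D_flat BP).
Local Notation T := (der_flat BP).

Lemma p_der_mor D : @is_der_mor (T D) D π1 π1.
Proof.
split; [exact: pi1_nu_flat | exact: pi1_alpha_flat | exact: pi1_D_flat].
Qed.

Lemma pi2_vector D : @is_vector (T D) D π1 π1 π2 π2.
Proof.
split; [exact: pi2_nu_flat | exact: pi2_alpha_flat | exact: pi2_D_flat].
Qed.

Lemma flat_der_mor P D (f : hom (der_A P) (der_A D ⊕ der_A D))
    (g : hom (der_M P) (der_M D ⊕ der_M D)) :
  @is_der_mor P D (π1 ∘ f) (π1 ∘ g) ->
  @is_vector P D (π1 ∘ f) (π1 ∘ g) (π2 ∘ f) (π2 ∘ g) ->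
  @is_der_mor P (T D) f g.
Proof.
case=> a1 a2 a3 [b1 b2 b3]; split.
- exact: flat_alg_mor.
- exact: flat_mod_mor.
- apply: bip_ext; rewrite !compmA.
    by rewrite a3 pi1_D_flat compmA.
  by rewrite b3 pi2_D_flat compmA.
Qed.

Lemma col_der_mor P D f g δ ε : @is_der_mor P D f g -> is_vector f g δ ε ->
  @is_der_mor P (T D) (mcol BP f δ) (mcol BP g ε).
Proof.
by move=> h1 h2; apply: flat_der_mor; rewrite !pi1_col ?pi2_col.
Qed.

Lemma F_der_mor D E f g : @is_der_mor D E f g -> @is_der_mor (T D) (T E) (F f) (F g).
Proof.
move=> h; apply: flat_der_mor; rewrite !pi1_D_flat ?pi2_D_flat.
  exact: der_mor_comp (p_der_mor D) h.
exact: comp_vector (pi2_vector D) h.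
Qed.

Lemma tz_der_mor D : @is_der_mor D (T D) (tz BP _) (tz BP _).
Proof. by apply: col_der_mor; [|apply: vector0]; exact: der_mor_id. Qed.

(** The lift pairs the morphism [(π1, 0)] with the vector [(0, π2)]. Summands involving a zero
    coordinate vanish, which leaves [pi2_vector]. *)
Lemma tl_der_mor D : is_Sderivation D ->
  @is_der_mor (T D) (T (T D)) (tl BP _) (tl BP _).
Proof.
move=> hD.
have h : @is_der_mor (T D) (T D) (mcol BP π1 0) (mcol BP π1 0).
  by apply: col_der_mor; [|apply: vector0]; exact: p_der_mor.
apply: col_der_mor => //; have [v1 v2 v3] := pi2_vector D.
have [hν _ _] := hD; have am := alg_m_flat BP hν.
case: D {h hD} => A ν M α D in hν am v1 v2 v3 *; rewrite /= in hν am v1 v2 v3 *.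
have z A' : π1 ∘ mcol BP (zerom (A' ⊕ A') A') π2 = 0 by rewrite pi1_col.
have t A' : π2 ∘ mcol BP (zerom (A' ⊕ A') A') π2 = π2 by rewrite pi2_col.
split=> /=; apply: bip_ext.
- by rewrite am pi1_dif_flat z compmA z dif0 comp0m.
- rewrite am pi2_dif_flat z t compmA t dif0 addm0 pi2_nu_flat compmA pi1_nu_flat.
  by rewrite -compmA -fmapM pi1_col.
- have := pi1_alpha_flat BP α; move: (alpha_flat BP α) => α' e.
  rewrite compmDr !compmA e !comp_tens_comp !pi1_col.
  by rewrite tensm0 tens0m !compm0 addm0 comp0m.
- have := pi2_alpha_flat BP α; move: (alpha_flat BP α) v2 => α' v2 e.
  rewrite compmDr !compmA e t v2 !compmDl !comp_tens_comp !pi1_col !pi2_col.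
  by rewrite !tensm0 !compm0 addm0 add0m.
- by rewrite !compmA pi1_D_flat z -compmA z comp0m compm0.
- by rewrite !compmA pi2_D_flat t -compmA t v3.
Qed.

Lemma tc_der_mor D : is_Sderivation D ->
  @is_der_mor (T (T D)) (T (T D)) (tc BP _) (tc BP _).
Proof.
move=> hD; have p := p_der_mor D.
apply: col_der_mor; first exact: F_der_mor p.
have [hν _ _] := hD; have am := alg_m_flat BP hν; have mon := alg_monoid hν.
case: D {hD p} => A ν M α D in hν am mon *; rewrite /= in hν am mon *.
split=> /=; [apply: bip_ext.. | by rewrite -!F_comp pi2_D_flat].
- rewrite compmA pi1_D_flat -compmA pi1_nu_flat compmA pi2_nu_flat dif_fmap.
  rewrite am pi1_dif_flat compmA pi1_nu_flat pi1_D_flat.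
  by rewrite -!compmA -!fmapM pi1_D_flat.
- rewrite compmA pi2_D_flat -compmA pi2_nu_flat am !pi2_dif_flat.
  rewrite pi1_D_flat pi2_D_flat !compmA !pi1_nu_flat !pi2_nu_flat !dif_fmap.
  rewrite -!compmA -!fmapM pi1_D_flat pi2_D_flat; congr (_ + _).
  (* What remains are mixed second derivatives along [π2 ∘ π1] and [π1 ∘ π2], in opposite orders. *)
  exact: dif_swap mon.
- have := pi2_alpha_flat BP α; have := pi1_alpha_flat BP α.
  have := pi1_alpha_flat BP (alpha_flat BP α).
  move: (alpha_flat BP (alpha_flat BP α)) => α2.
  move: (alpha_flat BP α) => α1 e21 e11 e12.
  rewrite compmDr !compmA pi1_D_flat e11 -compmA e21 compmA e12.
  by rewrite compmDl !comp_tens_comp !pi1_D_flat.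
- have := pi2_alpha_flat BP α; have := pi1_alpha_flat BP α.
  have := pi2_alpha_flat BP (alpha_flat BP α).
  move: (alpha_flat BP (alpha_flat BP α)) => α2.
  move: (alpha_flat BP α) => α1 e22 e11 e12.
  rewrite compmDr !compmA pi2_D_flat e12 -compmA e22 compmDr !compmA e12.
  rewrite !compmDl !comp_tens_comp !pi1_D_flat !pi2_D_flat.
  exact: addmACA.
Qed.

Definition T_obj (D : Derivation S) : Derivation S :=
  MkDerivation (der_flat_ax BP (der_ax D)).

End Flat.

Definition mor_of (D E : Derivation S) f g (h : @is_der_mor D E f g) : DerMor D E :=
  MkDerMor (der_mor_alg h) (der_mor_mod h) (der_mor_der h).

Lemma DerMorP (D E : Derivation S) (h : DerMor D E) :
  is_der_mor (dmor_f h) (dmor_g h).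
Proof. by split; case: h. Qed.

End DerivationMorphisms.

(** * Limits in S-DER *)

Section Limits.
Variables (X : AddSymMonCat) (S : DifferentialModality X).

(** With [reflect_mod]: the axioms of the target hold in the source after composition with the
    morphism, so a jointly monic family of morphisms forces them on the source. *)
Lemma reflect_alg (P D : DerData S) f g : is_Sderivation D -> @is_der_mor _ _ P D f g ->
  [/\ f ∘ (der_nu P ∘ am_eta S _) = f,
      f ∘ (der_nu P ∘ am_mu S _) = f ∘ (der_nu P ∘ fmap S (der_nu P))
    & g ∘ (der_D P ∘ der_nu P) = g ∘ dif (der_alpha P) (der_nu P) (der_D P)].
Proof.
case=> -[d1 dM] _ dd [f1 f2 f3]; split.
- by rewrite compmA f1 -compmA am_eta_nat compmA d1 comp1m.
- rewrite !compmA f1 -compmA am_mu_nat compmA dM -!compmA -!fmapM f1.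
  by rewrite fmapM !compmA.
- rewrite compmA f3 -compmA f1 compmA dd -/(dif _ _ _) dif_fmap -f1 -f3.
  by rewrite (comp_dif _ _ f2).
Qed.

Lemma reflect_mod (P D : DerData S) f g : is_Sderivation D -> @is_der_mor _ _ P D f g ->
  g ∘ (der_alpha P ∘ (1_ _ ⊠ der_alpha P) ∘ massoc _ _ _)
    = g ∘ (der_alpha P ∘ (alg_m (der_nu P) ⊠ 1_ _))
  /\ g ∘ (der_alpha P ∘ (alg_u (der_nu P) ⊠ 1_ _) ∘ mluniti _) = g.
Proof.
case=> _ hα _ [f1 f2 _].
have fm := alg_mor_m f1; have fu := alg_mor_u f1.
move: (alg_m _) (alg_u _) (alg_m _) (alg_u _) hα fm fu => m u m' u' hα fm fu.
rewrite !compmA f2 !comp_tens_comp !compm1 f2 fm fu; split.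
  exact: mod_tens hα.
exact: mod_unit hα.
Qed.

(** * Creation of fibre powers *)

Section Creation.
Variables (n : nat) (E D : Derivation S) (p : DerMor E D) (A M : X).
Variables (bA : hom A (der_A D)) (rA : 'I_n -> hom A (der_A E)).
Variables (bM : hom M (der_M D)) (rM : 'I_n -> hom M (der_M E)).
Variable FA : FibrePower (Y := X) (dmor_f p) bA rA.
Variable FM : FibrePower (Y := X) (dmor_g p) bM rM.

Lemma fp_nu_over i :
  dmor_f p ∘ (der_nu E ∘ fmap S (rA i)) = der_nu D ∘ fmap S bA.
Proof. by rewrite compmA dmor_alg -compmA -fmapM (fp_comm FA). Qed.

Lemma fp_alpha_over i :
  dmor_g p ∘ (der_alpha E ∘ (rA i ⊠ rM i)) = der_alpha D ∘ (bA ⊠ bM).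
Proof. by rewrite compmA dmor_mod comp_tens_comp (fp_comm FA) (fp_comm FM). Qed.

Lemma fp_D_over i : dmor_g p ∘ (der_D E ∘ rA i) = der_D D ∘ bA.
Proof. by rewrite compmA dmor_der -compmA (fp_comm FA). Qed.

Definition fp_data : DerData S :=
  MkDerData (fp_lift FA fp_nu_over) (fp_lift FM fp_alpha_over)
    (fp_lift FM fp_D_over).

Lemma fp_base_mor : @is_der_mor _ _ fp_data D bA bM.
Proof. by split; rewrite /is_alg_mor /= fp_lift_base. Qed.

Lemma fp_pr_mor i : @is_der_mor _ _ fp_data E (rA i) (rM i).
Proof. by split; rewrite /is_alg_mor /= fp_lift_pr. Qed.

Lemma fp_ax : is_Sderivation fp_data.
Proof.
have [b1 b2 b3] := reflect_alg (der_ax D) fp_base_mor.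
have [b4 b5] := reflect_mod (der_ax D) fp_base_mor.
have r i := reflect_alg (der_ax E) (fp_pr_mor i).
have r' i := reflect_mod (der_ax E) (fp_pr_mor i).
split; first split.
- by apply: (fp_lift_uniq FA) => [|i]; rewrite compm1 //; case: (r i).
- by apply: (fp_lift_uniq FA) => [|i] //; case: (r i).
- split.
  + by apply: (fp_lift_uniq FM) => [|i] //; case: (r' i).
  + by apply: (fp_lift_uniq FM) => [|i]; rewrite compm1 //; case: (r' i).
- by apply: (fp_lift_uniq FM) => [|i] //; case: (r i).
Qed.

Definition fp_obj : Derivation S := MkDerivation fp_ax.
Definition fp_base : DerMor fp_obj D := @mor_of _ _ fp_obj D _ _ fp_base_mor.
Definition fp_pr i : DerMor fp_obj E := @mor_of _ _ fp_obj E _ _ (fp_pr_mor i).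
End Creation.

(** Reflection rather than creation: it also covers the images under powers of the tangent functor,
    whose apex is not built by [fp_data]. Lifts are morphisms because the legs are jointly monic. *)
Definition SDER_fp (n : nat) (E D P : Derivation S) (p : DerMor E D)
    (b : DerMor P D) (r : 'I_n -> DerMor P E) :
  FibrePower (Y := X) (dmor_f p) (dmor_f b) (fun i => dmor_f (r i)) ->
  FibrePower (Y := X) (dmor_g p) (dmor_g b) (fun i => dmor_g (r i)) ->
  @FibrePower (SDER S) n E D p P b r.
Proof.
move=> FA FM.
have paA (Z : Derivation S) (b' : DerMor Z D) (a : 'I_n -> DerMor Z E) :
    (forall i, der_comp p (a i) = b') ->
    forall i, dmor_f p ∘ dmor_f (a i) = dmor_f b'.
  by move=> pa i; rewrite -(pa i).
have paM (Z : Derivation S) (b' : DerMor Z D) (a : 'I_n -> DerMor Z E) :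
    (forall i, der_comp p (a i) = b') ->
    forall i, dmor_g p ∘ dmor_g (a i) = dmor_g b'.
  by move=> pa i; rewrite -(pa i).
have lift (Z : Derivation S) (b' : DerMor Z D) (a : 'I_n -> DerMor Z E)
    (pa : forall i, der_comp p (a i) = b') :
    @is_der_mor _ _ Z P (fp_lift FA (paA Z b' a pa)) (fp_lift FM (paM Z b' a pa)).
  have [b1 b2 b3] := DerMorP b; have [c1 c2 c3] := DerMorP b'.
  split; [apply: (fp_lift_uniq FA) => [|i] | apply: (fp_lift_uniq FM) => [|i]
         | apply: (fp_lift_uniq FM) => [|i]];
  rewrite !compmA ?fp_lift_base ?fp_lift_pr.
  - by rewrite b1 c1 -compmA -fmapM fp_lift_base.
  - by rewrite !dmor_alg -compmA -fmapM fp_lift_pr.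
  - by rewrite b2 c2 comp_tens_comp !fp_lift_base.
  - by rewrite !dmor_mod comp_tens_comp !fp_lift_pr.
  - by rewrite b3 c3 -compmA fp_lift_base.
  - by rewrite !dmor_der -compmA fp_lift_pr.
refine (@MkFibrePower (SDER S) n E D p P b r _
          (fun Z b' a pa => mor_of (lift Z b' a pa)) _ _ _).
- by move=> i; apply: DerMor_eq; [exact: (fp_comm FA i) | exact: (fp_comm FM i)].
- by move=> Z b' a pa; apply: DerMor_eq; rewrite /= fp_lift_base.
- by move=> Z b' a pa i; apply: DerMor_eq;
  [exact: (fp_lift_pr FA) | exact: (fp_lift_pr FM)].
- move=> Z h k e1 e2; apply: DerMor_eq.
    apply: (fp_lift_uniq FA) => [|i]; first exact: (congr1 (@dmor_f _ _ _ _) e1).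
    exact: (congr1 (@dmor_f _ _ _ _) (e2 i)).
  apply: (fp_lift_uniq FM) => [|i]; first exact: (congr1 (@dmor_g _ _ _ _) e1).
  exact: (congr1 (@dmor_g _ _ _ _) (e2 i)).
Defined.

Lemma SDER_pullback (A B C P : Derivation S) (f : DerMor A C) (g : DerMor B C)
    (p1 : DerMor P A) (p2 : DerMor P B) :
  is_pullback (Y := X) (dmor_f f) (dmor_f g) (dmor_f p1) (dmor_f p2) ->
  is_pullback (Y := X) (dmor_g f) (dmor_g g) (dmor_g p1) (dmor_g p2) ->
  @is_pullback (SDER S) A B C P f g p1 p2.
Proof.
move=> [cA uA] [cM uM]; split; first exact: DerMor_eq.
move=> Z a b e.
have eA : dmor_f f ∘ dmor_f a = dmor_f g ∘ dmor_f b
  by exact: (congr1 (@dmor_f _ _ _ _) e).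
have eM : dmor_g f ∘ dmor_g a = dmor_g g ∘ dmor_g b
  by exact: (congr1 (@dmor_g _ _ _ _) e).
(* Uniqueness in a pullback, recast as joint monicity of its legs. *)
have monic (Q P' A' B' : X) (f1 : hom P' A') (f2 : hom P' B') C'
    (g1 : hom A' C') (g2 : hom B' C') :
    g1 ∘ f1 = g2 ∘ f2 ->
    (forall Z' (a' : hom Z' A') (b' : hom Z' B'), g1 ∘ a' = g2 ∘ b' ->
       exists! h, f1 ∘ h = a' /\ f2 ∘ h = b') ->
    forall h k : hom Q P', f1 ∘ h = f1 ∘ k -> f2 ∘ h = f2 ∘ k -> h = k.
  move=> c u h k e1 e2.
  have [|w [_ uw]] := u Q (f1 ∘ h) (f2 ∘ h); first by rewrite !compmA c.
  by rewrite -(uw h) // -(uw k).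
have [hA [[a1 a2] a3]] := uA _ _ _ eA; have [hM [[m1 m2] m3]] := uM _ _ _ eM.
have hh : @is_der_mor _ _ Z P hA hM.
  split; [apply: (monic _ _ _ _ _ _ _ _ _ cA uA)
    | apply: (monic _ _ _ _ _ _ _ _ _ cM uM)..]; rewrite !compmA.
  - by rewrite a1 !dmor_alg -compmA -fmapM a1.
  - by rewrite a2 !dmor_alg -compmA -fmapM a2.
  - by rewrite m1 !dmor_mod comp_tens_comp m1 a1.
  - by rewrite m2 !dmor_mod comp_tens_comp m2 a2.
  - by rewrite m1 !dmor_der -compmA a1.
  - by rewrite m2 !dmor_der -compmA a2.
exists (mor_of hh); split; first by split; apply: DerMor_eq.
move=> k [k1 k2]; apply: DerMor_eq => /=.
  by apply: a3; split; [exact: (congr1 (@dmor_f _ _ _ _) k1)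
                       | exact: (congr1 (@dmor_f _ _ _ _) k2)].
by apply: m3; split; [exact: (congr1 (@dmor_g _ _ _ _) k1)
                     | exact: (congr1 (@dmor_g _ _ _ _) k2)].
Qed.
End Limits.

(** * The tangent structure of S-DER *)

Section DerivationTangent.
Variables (X : AddSymMonCat) (S : DifferentialModality X).
Variable BP : FiniteBiproducts X.
Local Notation π1 := (bpi1 BP _ _).
Local Notation π2 := (bpi2 BP _ _).
Local Notation F := (D_flat BP).

Definition T_fun : Functor (SDER S) (SDER S).
Proof.
refine (@MkFunctor (SDER S) (SDER S) (T_obj BP)
  (fun D E h => @mor_of _ _ (T_obj BP D) (T_obj BP E) _ _ (F_der_mor BP (DerMorP h)))
  _ _).
- by move=> D; apply: DerMor_eq; rewrite /= F_id.
- by move=> D E G k h; apply: DerMor_eq; rewrite /= F_comp.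
Defined.

Definition T_p (D : Derivation S) : DerMor (T_obj BP D) D :=
  @mor_of _ _ (T_obj BP D) D _ _ (p_der_mor BP D).

Definition T_pow n (D : Derivation S) : Derivation S :=
  @fp_obj _ _ n (T_obj BP D) D (T_p D) _ _ _ _ _ _
    (tpow_fp BP n (der_A D)) (tpow_fp BP n (der_M D)).

Definition T_base n (D : Derivation S) : DerMor (T_pow n D) D :=
  @fp_base _ _ n (T_obj BP D) D (T_p D) _ _ _ _ _ _
    (tpow_fp BP n (der_A D)) (tpow_fp BP n (der_M D)).

Definition T_pr n (D : Derivation S) (i : 'I_n) : DerMor (T_pow n D) (T_obj BP D) :=
  @fp_pr _ _ n (T_obj BP D) D (T_p D) _ _ _ _ _ _
    (tpow_fp BP n (der_A D)) (tpow_fp BP n (der_M D)) i.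

Definition T_fp k n (D : SDER S) :
  @FibrePower (SDER S) n _ _ (fmap (functor_pow T_fun k) (T_p D)) _
    (fmap (functor_pow T_fun k) (T_base n D))
    (fun i => fmap (functor_pow T_fun k) (T_pr D i)).
Proof.
apply: SDER_fp.
- elim: k => [|k IH]; [exact: tpow_fp | exact: F_fp IH].
- elim: k => [|k IH]; [exact: tpow_fp | exact: F_fp IH].
Defined.

(** Each projection contributes a vector; [e] identifies the morphisms they lie over, so that
    [vectorD] can add them. *)
Lemma ts_der_mor (D : Derivation S) :
  @is_der_mor _ _ (T_pow 2 D) (T_obj BP D) (ts BP _) (ts BP _).
Proof.
have b := DerMorP (T_base 2 D).
have e A (i : 'I_2) : π1 ∘ tpow_pr BP A i = π1 by rewrite pi1_col.
have v i : @is_vector _ _ (T_pow 2 D) D (π1 ∘ tpow_pr BP _ i) (π1 ∘ tpow_pr BP _ i)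
    (π2 ∘ tpow_pr BP _ i) (π2 ∘ tpow_pr BP _ i).
  exact: vector_comp (DerMorP (T_pr D i)) (pi2_vector BP D).
by apply: col_der_mor b _; apply: vectorD; [have := v ord0 | have := v ord_max];
  rewrite !e.
Qed.

Definition T_s (D : Derivation S) : DerMor (T_pow 2 D) (T_obj BP D) :=
  mor_of (ts_der_mor D).

Definition T_z (D : Derivation S) : DerMor D (T_obj BP D) :=
  @mor_of _ _ D (T_obj BP D) _ _ (tz_der_mor BP D).

Definition T_l (D : Derivation S) : DerMor (T_obj BP D) (T_obj BP (T_obj BP D)) :=
  @mor_of _ _ (T_obj BP D) (T_obj BP (T_obj BP D)) _ _ (tl_der_mor BP (der_ax D)).

Definition T_c (D : Derivation S) :
    DerMor (T_obj BP (T_obj BP D)) (T_obj BP (T_obj BP D)) :=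
  @mor_of _ _ (T_obj BP (T_obj BP D)) (T_obj BP (T_obj BP D)) _ _
    (tc_der_mor BP (der_ax D)).

Definition T_data : TangentData (SDER S) :=
  @MkTangentData (SDER S) T_fun T_p T_pow T_base T_pr T_fp T_s T_z T_l T_c.

Lemma T_s_comp (Z D : SDER S) (h : hom Z (T_pow 2 D)) (b : hom Z D)
    (x y : hom Z (T_obj BP D : SDER S)) :
  (T_base 2 D : hom (T_pow 2 D : SDER S) D) ∘ h = b ->
  (T_pr D (@ord0 1) : hom (T_pow 2 D : SDER S) (T_obj BP D)) ∘ h = x ->
  (T_pr D (@ord_max 1) : hom (T_pow 2 D : SDER S) (T_obj BP D)) ∘ h = y ->
  dmor_f (T_s D) ∘ dmor_f h
    = mcol BP (dmor_f b) (π2 ∘ dmor_f x + π2 ∘ dmor_f y) /\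
  dmor_g (T_s D) ∘ dmor_g h
    = mcol BP (dmor_g b) (π2 ∘ dmor_g x + π2 ∘ dmor_g y).
Proof. by move=> <- <- <-; split; apply: ts_comp. Qed.

Lemma T_Fs_comp (Z D : SDER S) (h : hom Z (T_obj BP (T_pow 2 D)))
    (b : hom Z (T_obj BP D))
    (x y : hom Z (T_obj BP (T_obj BP D) : SDER S)) :
  fmap T_fun (T_base 2 D) ∘ h = b -> fmap T_fun (T_pr D (@ord0 1)) ∘ h = x ->
  fmap T_fun (T_pr D (@ord_max 1)) ∘ h = y ->
  dmor_f (fmap T_fun (T_s D) ∘ h)
    = mcol BP (mcol BP (π1 ∘ dmor_f b) (π2 ∘ π1 ∘ dmor_f x + π2 ∘ π1 ∘ dmor_f y))
              (mcol BP (π2 ∘ dmor_f b) (π2 ∘ π2 ∘ dmor_f x + π2 ∘ π2 ∘ dmor_f y)) /\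
  dmor_g (fmap T_fun (T_s D) ∘ h)
    = mcol BP (mcol BP (π1 ∘ dmor_g b) (π2 ∘ π1 ∘ dmor_g x + π2 ∘ π1 ∘ dmor_g y))
              (mcol BP (π2 ∘ dmor_g b) (π2 ∘ π2 ∘ dmor_g x + π2 ∘ π2 ∘ dmor_g y)).
Proof. by move=> <- <- <-; split; apply: F_ts_comp. Qed.

Lemma T_s_pair (D Z : SDER S) (b : hom Z D) (x y : hom Z (tan_T T_data D))
    (px : tan_p T_data D ∘ x = b) (py : tan_p T_data D ∘ y = b) :
  dmor_f (tan_s T_data D ∘ fp_pair (tan_fp T_data 0 2 D) px py)
    = mcol BP (dmor_f b) (π2 ∘ dmor_f x + π2 ∘ dmor_f y) /\
  dmor_g (tan_s T_data D ∘ fp_pair (tan_fp T_data 0 2 D) px py)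
    = mcol BP (dmor_g b) (π2 ∘ dmor_g x + π2 ∘ dmor_g y).
Proof.
apply: T_s_comp.
- exact: (fp_lift_base (tan_fp T_data 0 2 D)).
- exact: (fp_lift_pr (tan_fp T_data 0 2 D) _ ord0).
- exact: (fp_lift_pr (tan_fp T_data 0 2 D) _ ord_max).
Qed.

(** By [T_s_pair], addition acts on vertical coordinates only, so the laws are those of addition in
    hom-sets. *)
Lemma T_additive (D : SDER S) : is_additive_bundle (tan_bundle T_data D).
Proof.
have ps : ab_p (tan_bundle T_data D) ∘ ab_s (tan_bundle T_data D)
    = ab_base (tan_bundle T_data D).
  by apply: DerMor_eq; exact: pi1_col.
have pz : ab_p (tan_bundle T_data D) ∘ ab_z (tan_bundle T_data D) = 1_ _.
  by apply: DerMor_eq; exact: p_tz.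
refine (@Build_is_additive_bundle _ _ ps pz _ _ _).
- move=> Z b x y w px py pw.
  have [e1 e2] := T_s_pair px (bundle_s_over ps py pw).
  have [e3 e4] := T_s_pair (bundle_s_over ps px py) pw.
  have [e5 e6] := T_s_pair px py.
  have [e7 e8] := T_s_pair py pw.
  apply: DerMor_eq.
    refine (etrans e1 (etrans _ (esym e3))).
    by rewrite [in RHS]e5 [in LHS]e7 !pi2_col addmA.
  refine (etrans e2 (etrans _ (esym e4))).
  by rewrite [in RHS]e6 [in LHS]e8 !pi2_col addmA.
- have [e1 e2] := T_s_pair (fp_comm (tan_fp T_data 0 2 D) ord_max)
                    (fp_comm (tan_fp T_data 0 2 D) ord0).
  apply: DerMor_eq.
    by refine (etrans e1 _); rewrite addmC.
  by refine (etrans e2 _); rewrite addmC.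
- have [e1 e2] := T_s_pair (bundle_z_over pz) (compm1 (tan_p T_data D)).
  have e A : mcol BP (bpi1 BP A A) (π2 ∘ (tz BP A ∘ π1) + π2 ∘ 1_ _) = 1_ _.
    apply: bip_ext; rewrite ?pi1_col ?pi2_col compm1 //.
    by rewrite compmA pi2_col comp0m add0m.
  apply: DerMor_eq; [exact: (etrans e1 (e _)) | exact: (etrans e2 (e _))].
Qed.

Lemma T_nat (D D' : SDER S) (f : hom D D') :
  @is_bundle_morph _ (tan_bundle T_data D) (tan_bundle T_data D')
    (fmap T_fun f) f.
Proof.
pose B := tan_bundle T_data D; pose B' := tan_bundle T_data D'.
have p : ab_p B' ∘ (fmap T_fun f : hom (ab_E B) (ab_E B')) = f ∘ ab_p B.
  by apply: DerMor_eq; exact: pi1_D_flat.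
have pr i := fp_lift_pr (ab_fp B') (bundle_morph_over p) i.
have [e1 e2] := T_s_comp (fp_lift_base (ab_fp B') (bundle_morph_over p))
  (pr ord0) (pr ord_max).
refine (@Build_is_bundle_morph _ B B' _ _ p _ _).
- apply: DerMor_eq; [exact: (etrans (F_ts _ _) (esym e1))
                    | exact: (etrans (F_ts _ _) (esym e2))].
- by apply: DerMor_eq; exact: tz_nat.
Qed.

Lemma T_l_bundle (D : SDER S) :
  @is_bundle_morph _ (tan_bundle T_data D) (tan_Tbundle T_data D) (T_l D) (T_z D).
Proof.
pose B := tan_bundle T_data D; pose B' := tan_Tbundle T_data D.
have p : ab_p B' ∘ (T_l D : hom (ab_E B) (ab_E B'))
    = (T_z D : hom (ab_X B) (ab_X B')) ∘ ab_p B.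
  by apply: DerMor_eq; exact: Fp_tl.
have pr i := fp_lift_pr (ab_fp B') (bundle_morph_over p) i.
have [e1 e2] := T_Fs_comp (fp_lift_base (ab_fp B') (bundle_morph_over p))
  (pr ord0) (pr ord_max).
refine (@Build_is_bundle_morph _ B B' _ _ p _ _).
- apply: DerMor_eq; [exact: (etrans (tl_ts _ _) (esym e1))
                    | exact: (etrans (tl_ts _ _) (esym e2))].
- by apply: DerMor_eq; exact: tl_tz.
Qed.

Lemma T_c_bundle (D : SDER S) :
  @is_bundle_morph _ (tan_Tbundle T_data D) (tan_bundle T_data (T_obj BP D))
    (T_c D) (1_ (T_obj BP D : SDER S)).
Proof.
pose B := tan_Tbundle T_data D; pose B' := tan_bundle T_data (T_obj BP D).
have p : ab_p B' ∘ (T_c D : hom (ab_E B) (ab_E B'))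
    = (1_ (T_obj BP D : SDER S) : hom (ab_X B) (ab_X B')) ∘ ab_p B.
  by apply: DerMor_eq; exact: p_tc.
have pr i := fp_lift_pr (ab_fp B') (bundle_morph_over p) i.
have [e1 e2] := T_s_comp (fp_lift_base (ab_fp B') (bundle_morph_over p))
  (pr ord0) (pr ord_max).
refine (@Build_is_bundle_morph _ B B' _ _ p _ _).
- apply: DerMor_eq; [exact: (etrans (tc_F_ts _ _) (esym e1))
                    | exact: (etrans (tc_F_ts _ _) (esym e2))].
- by apply: DerMor_eq; exact: tc_Ftz.
Qed.

(** The proofs [pl] and [pz], on which [tan_v] depends, are arbitrary so as to fit those occurring
    in [is_tangent]. Each component starts from [tv_pullback]. *)
Lemma T_vert (k : nat) (D : SDER S) pl pz :
  is_pullback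
    (fmap (functor_pow T_fun k) (fmap T_fun (T_p D)))
    (fmap (functor_pow T_fun k) (T_z D : hom D (T_obj BP D)))
    (fmap (functor_pow T_fun k) (@tan_v _ T_data D pl pz))
    (fmap (functor_pow T_fun k)
       ((T_p D : hom (T_obj BP D : SDER S) D) ∘ T_pr D (@ord0 1))).
Proof.
have [v1 v2] : dmor_f (@tan_v _ T_data D pl pz) = _
    /\ dmor_g (@tan_v _ T_data D pl pz) = _
  := T_Fs_comp (fp_lift_base (tan_fp T_data 1 2 D)
         (fam2P (tan_vert_l pl) (tan_vert_z pz)))
       (fp_lift_pr (tan_fp T_data 1 2 D)
         (fam2P (tan_vert_l pl) (tan_vert_z pz)) ord0)
       (fp_lift_pr (tan_fp T_data 1 2 D)
         (fam2P (tan_vert_l pl) (tan_vert_z pz)) ord_max).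
have w1 := tv_pullback (etrans v1 (tvE _ _)).
have w2 := tv_pullback (etrans v2 (tvE _ _)).
apply: SDER_pullback; elim: k => [|k IH].
- exact: w1.
- exact: F_pullback IH.
- exact: w2.
- exact: F_pullback IH.
Qed.

Lemma T_tangent : is_tangent T_data.
Proof.
refine (@Build_is_tangent _ T_data T_additive T_nat _ _ T_l_bundle T_c_bundle
  _ _ _ _ _ _).
- by move=> D D' f; apply: DerMor_eq; exact: tl_nat.
- by move=> D D' f; apply: DerMor_eq; exact: tc_nat.
- by move=> D; apply: DerMor_eq; exact: tc_tc.
- by move=> D; apply: DerMor_eq; exact: tc_tl.
- by move=> D; apply: DerMor_eq; exact: tl_tl.
- by move=> D; apply: DerMor_eq; exact: tc_tc_tc.
- by move=> D; apply: DerMor_eq; exact: tc_tc_tl.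
- by move=> k D; exact: T_vert.
Qed.
End DerivationTangent.

Theorem corollary8p1 (X : AddSymMonCat) (S : DifferentialModality X)
    (BP : FiniteBiproducts X) :
  exists t : TangentStructure (SDER S),
    forall D : Derivation S, der_data (tan_T t D) = der_flat BP D.
(* The equality of data holds by computation, as [T_obj] wraps [der_flat]. *)
Proof. by exists (MkTangentStructure (T_tangent S BP)). Qed.
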